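(* Let $\tau_1$ be an SRCT of straight shape $\alpha\vDash n$, let $j_1,\ldots,j_m$ be positive integers such that the slides below are all defined, and let $\tau_2=\mu_{j_m}\cdots\mu_{j_1}(\tau_1)$ in the bullet convention. Let $w=j_m\cdots j_1$, $\omega=\mathrm{std}(w)\in\mathfrak{S}_m$, $\beta=u_{j_m}\cdots u_{j_1}(\alpha)$ and $\gamma=\mathrm{sh}(\rho^{-1}(Q(\omega)))$. Then $\tau_2$ is an SRCT of shape $\beta/\!\!/\gamma$.
   Context: Compositions as reverse composition diagrams (row $r$ from top has $\alpha_r$ left-justified boxes); $\mathrm{sh}$ denotes shape. For a skew shape $\beta/\!\!/\gamma$, the inner shape $\gamma$ occupies, left-justified, the last $l(\gamma)$ rows of $\beta$. An SSRCT of shape $\beta/\!\!/\gamma$: filling of the non-inner boxes, rows weakly decreasing left to right, filled first-column entries strictly increasing top to bottom, and for rows $r<s$ and column $c$ with $(s,c+1)$ filled: if $(r,c)$ is inner or $\tau(r,c)\geq\tau(s,c+1)$, then $(r,c+1)$ is inner or filled with $\tau(r,c+1)>\tau(s,c+1)$. An SRCT is an SSRCT whose entries are $1,\ldots,N$ each once ($N$ the number of filled boxes). $\rho$ sorts each column of an SSRCT of straight shape decreasingly bottom to top, bottom-justified, giving an SSRT (French convention); it is a known bijection. Operators: $\mathfrak{d}_t$ subtracts $1$ from the rightmost part equal to $t$ (omitting $0$; $0$ if none), $\mathfrak{v}_{[t-1]}=\mathfrak{d}_1\cdots\mathfrak{d}_{t-1}$ ($\mathfrak{d}_{t-1}$ first),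 $a_t$ appends $t$, $u_t=a_t\mathfrak{v}_{[t-1]}$. $\mathrm{std}(w)$: replace the letters of $w$ (read left to right) by $1,\ldots,m$, smaller letters first, ties broken left to right. Variant RS: insert $\omega(1),\ldots,\omega(m)$ into SRTs with decreasing rows, starting in the bottom row: $y$ bumps the greatest entry $x<y$ of the row (if any) and $x$ is inserted in the next row up; otherwise $y$ is appended at the end of the row; the $k$-th new box receives $m-k+1$ in the recording tableau $Q(\omega)$. $\phi_{t+1}$ on an SSRCT $\tau$ of straight shape with a part equal to $t$ ($\tau=0$ outside): $r_1$ largest row index of a part equal to $t$; $r_p$ ($p\geq2$) the largest $r<r_{p-1}$ with $\tau(r,t)>\tau(r_{p-1},t)\geq\tau(r,t+1)$, ending at $r_k$; for $p=k,\ldots,2$ put the original $\tau(r_{p-1},t)$ into $(r_p,t)$, delete box $(r_1,t)$ (and its row if empty); $\tau(r_k,t)$ exits. $\mu_i$ with the max-convention: $\tau'=\tau$, $H=\varnothing$ if $i=1$, else $\tau'=\phi_2(\cdots\phi_i(\tau)\cdots)$ with $H$ the exiting entries; $\mu_i(\tau)$ is $\tau'$ with a new last row of length $i$ containing $\max(\tau)+1$ in its first box followed by $H$ decreasingly. A slide $\mu_i$ is defined when the sorted partition of the current shape has an addable node in column $i$. Bullet convention: compute $\mu_{j_m}\cdots\mu_{j_1}(\tau_1)$ with the max-convention and then replace every entry greater than $n$ by an empty (inner) box. *)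

(* Defs.v *)
From mathcomp Require Import all_boot.
Set Implicit Arguments. Unset Strict Implicit. Unset Printing Implicit Defensive.

(* Tableaux of (skew) reverse composition shape.
   A tableau is a seq of rows, row 0 = TOP row, each row listed left to
   right.  Entries are positive naturals; the value 0 marks an INNER box
   (a box of the inner shape gamma).  Indices (row, column) are 0-based. *)

Definition tab := seq (seq nat).

Definition entry (T : tab) (r c : nat) : nat := nth 0 (nth [::] T r) c.
Definition in_diag (T : tab) (r c : nat) : bool :=
  (r < size T) && (c < size (nth [::] T r)).
Definition inner (T : tab) (r c : nat) : bool := in_diag T r c && (entry T r c == 0).
Definition filled (T : tab) (r c : nat) : bool := in_diag T r c && (entry T r c != 0).

Definition is_comp (a : seq nat) : bool := all (fun x => 0 < x) a.

Definition skew_shaped (T : tab) (beta gamma : seq nat) : bool :=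
  [&& map size T == beta, is_comp beta, is_comp gamma, size gamma <= size beta &
   all (fun r =>
          let g := nth 0 (nseq (size beta - size gamma) 0 ++ gamma) r in
          (g <= nth 0 beta r) &&
          all (fun c => (entry T r c == 0) == (c < g)) (iota 0 (nth 0 beta r)))
       (iota 0 (size beta))].

Definition is_SSRCT (T : tab) (beta gamma : seq nat) : Prop :=
  [/\ skew_shaped T beta gamma,
   (forall r c c', c < c' -> filled T r c -> filled T r c' ->
                   entry T r c' <= entry T r c),
   (forall r s, r < s -> filled T r 0 -> filled T s 0 -> entry T r 0 < entry T s 0) &
   (forall r s c, r < s -> filled T s c.+1 ->
      inner T r c || (filled T r c && (entry T s c.+1 <= entry T r c)) ->
      inner T r c.+1 || (filled T r c.+1 && (entry T s c.+1 < entry T r c.+1)))].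

Definition is_SRCT (T : tab) (beta gamma : seq nat) : Prop :=
  is_SSRCT T beta gamma /\
  perm_eq [seq x <- flatten T | x != 0]
          (iota 1 (count (fun x => x != 0) (flatten T))).

(* Operators on compositions; None represents the zero element 0.      *)

Definition dop (t : nat) (a : option (seq nat)) : option (seq nat) :=
  match a with
  | None => None
  | Some al =>
      if t \in al then
        let i := (size al).-1 - index t (rev al) in
        Some (take i al ++ (if t.-1 == 0 then [::] else [:: t.-1]) ++ drop i.+1 al)
      else None
  end.

Fixpoint vops (k : nat) (a : option (seq nat)) : option (seq nat) :=
  match k with
  | 0 => a
  | k'.+1 => vops k' (dop k a)
  end.

Definition aop (t : nat) (a : option (seq nat)) : option (seq nat) :=
  omap (fun al => rcons al t) a.

Definition uop (t : nat) (a : option (seq nat)) : option (seq nat) :=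
  aop t (vops t.-1 a).

Definition ucomp (js : seq nat) (alpha : seq nat) : option (seq nat) :=
  foldl (fun a j => uop j a) (Some alpha) js.

(* Here tableaux are of straight shape (no inner boxes); entry is 0    *)
(* outside the diagram.  1-based column t is 0-based column t.-1.      *)

Definition set_entry (T : tab) (r c v : nat) : tab :=
  set_nth [::] T r (set_nth 0 (nth [::] T r) c v).

Fixpoint chain (T : tab) (t r fuel : nat) : seq nat :=
  r :: match fuel with
       | 0 => [::]
       | f.+1 =>
           let cands := [seq s <- iota 0 r |
                          (entry T r t.-1 < entry T s t.-1) &&
                          (entry T s t <= entry T r t.-1)] in
           if cands is [::] then [::] else chain T t (last 0 cands) f
       end.

Definition phi (t1 : nat) (T : tab) : tab * nat :=
  let t := t1.-1 in
  let r1 := (size T).-1 - index t (rev (map size T)) in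
  let ch := chain T t r1 (size T) in
  let T' := foldl (fun U (pr : nat * nat) =>
                     set_entry U pr.1 t.-1 (entry T pr.2 t.-1))
                  T (zip (behead ch) ch) in
  let T'' := if t.-1 == 0 then take r1 T' ++ drop r1.+1 T'
             else set_nth [::] T' r1 (take t.-1 (nth [::] T' r1)) in
  (T'', entry T (last r1 ch) t.-1).

Fixpoint phis (k : nat) (T : tab) : tab * seq nat :=
  match k with
  | 0 => (T, [::])
  | k'.+1 =>
      let (T1, h) := phi k'.+2 T in
      let (T2, H) := phis k' T1 in
      (T2, h :: H)
  end.

Definition maxT (T : tab) : nat := foldr maxn 0 (flatten T).

Definition mu (i : nat) (T : tab) : tab :=
  let (T', H) := phis i.-1 T in
  rcons T' ((maxT T).+1 :: sort geq H).

(* the sorted partition lambda has an addable node in (1-based) column i *)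
Definition addable (lam : seq nat) (i : nat) : bool :=
  has (fun r => (nth 0 lam r == i.-1) && ((r == 0) || (i <= nth 0 lam r.-1)))
      (iota 0 (size lam).+1).

Fixpoint slides_defined (T : tab) (js : seq nat) : bool :=
  match js with
  | [::] => true
  | j :: js' => addable (sort geq (map size T)) j && slides_defined (mu j T) js'
  end.

Definition bullet (n : nat) (T : tab) (js : seq nat) : tab :=
  map (map (fun x => if n < x then 0 else x)) (foldl (fun U j => mu j U) T js).

(* SRTs are in French convention: seq of rows, row 0 = BOTTOM row.     *)

Definition std (w : seq nat) : seq nat :=
  [seq (count (fun y => y < nth 0 w i) w + count (pred1 (nth 0 w i)) (take i w)).+1
  | i <- iota 0 (size w)].

Fixpoint rs_ins (P : tab) (y : nat) : tab * nat :=
  match P with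
  | [::] => ([:: [:: y]], 0)
  | row :: rest =>
      let cands := [seq x <- row | x < y] in
      if cands is [::] then (rcons row y :: rest, 0)
      else
        let x := foldr maxn 0 cands in
        let (rest', k) := rs_ins rest x in
        (set_nth 0 row (index x row) y :: rest', k.+1)
  end.

Definition add_box (Q : tab) (k v : nat) : tab :=
  set_nth [::] Q k (rcons (nth [::] Q k) v).

Fixpoint rs_aux (P Q : tab) (k m : nat) (ws : seq nat) : tab * tab :=
  match ws with
  | [::] => (P, Q)
  | y :: ws' =>
      let (P', r) := rs_ins P y in
      rs_aux P' (add_box Q r (m - k + 1)) k.+1 m ws'
  end.

Definition recording (om : seq nat) : tab := (rs_aux [::] [::] 1 (size om) om).2.

(* rho: sort each column decreasingly bottom to top, bottom-justified;
   result in French convention (row 0 = bottom) *)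
Definition rho (S : tab) : tab :=
  let cols := [seq sort geq [seq entry S r c | r <- iota 0 (size S) &
                                              c < size (nth [::] S r)]
              | c <- iota 0 (foldr maxn 0 (map size S))] in
  [seq [seq nth 0 col k | col <- cols & k < size col]
  | k <- iota 0 (foldr maxn 0 (map size cols))].

(* Main.v *)
Require Import Defs.
From mathcomp Require Import all_boot zify.
Set Implicit Arguments. Unset Strict Implicit. Unset Printing Implicit Defensive.

(* Each slide [mu j] moves at most one entry from every column to the next one,
   so for every threshold [k] the part of the tableau with entries above [k]
   gains exactly one box, in column [level k j T].  Along the whole sequence of
   slides these columns form a word; for [k = 0] it is [j_m ... j_1], and for
   [k = n] it is a Yamanouchi word describing the growth of the bullets.  Passing
   from [k] to [k + 1] lowers some letters c+1 to c, each time at the leftmost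
   unmatched c+1 of the bracketing of c against c+1, and this preserves the shape
   of the insertion tableau.  Since the insertion tableau of a Yamanouchi word has
   column lengths equal to the letter counts, the sorted shape of the bullets is
   the shape of the insertion tableau of [j_m ... j_1].  Applying this to all the
   tails [j_i, ..., j_m] locates every bullet, so the relabelled bullets form an
   SSRCT whose image under [rho] is the recording tableau; injectivity of [rho]
   then identifies the inner shape. *)

(** * Row insertion of words *)

(** A slide reroutes entries along chains that depend on the whole tableau, so following a bullet
    from row to row is hopeless. What stays manageable is the content of the columns: an entry
    leaving a column goes to the next one, and at that moment both columns hold equally many larger
    entries ([phi_above]). This balance is what makes the letter changed between two thresholds the
    leftmost unmatched c+1. Bracketing is invariant under row bumping, but the changed letter itself
    may be absorbed by a row or handed on by it. Shape invariance is therefore proved one row at a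
    time, for two words that differ in a single letter. Level words have repeated letters, and their
    standardizations differ from one threshold to the next. Insertion is therefore run on the words
    themselves, with weak comparison [leq] in place of [ltn]; standardization enters only when the
    recording tableau is computed. In w = j_m ... j_1 the first slide is the last letter inserted.
    Its box receives the label 1, in agreement with its bullet n+1 being the smallest one. *)

Lemma gtn_trans : transitive gtn.
Proof. by move=> y x z /= xy yz; apply: ltn_trans yz xy. Qed.

(** Rows decrease, so the first entry found is the greatest one that can be bumped. If there is
    none, the index is [size R] and [set_nth] appends, so one formula covers both cases. The second
    component is the word of bumped letters, in order. *)
Fixpoint row_pass (lt : rel nat) (R w : seq nat) : seq nat * seq nat :=
  if w is y :: w' then
    let i := find (lt^~ y) R in
    let RB := row_pass lt (set_nth 0 R i y) w' in
    (RB.1, if i < size R then nth 0 R i :: RB.2 else RB.2)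
  else (R, [::]).

(** The relation is a parameter because the same bumping runs with [ltn] on standardized words and
    with [leq] on the original ones: ties are broken left to right, so an equal earlier letter
    counts as smaller and is bumped. *)
Fixpoint ins (lt : rel nat) (P : tab) (y : nat) : tab * nat :=
  if P is row :: rest then
    let i := find (lt^~ y) row in
    if i < size row then
      let Pk := ins lt rest (nth 0 row i) in
      (set_nth 0 row i y :: Pk.1, Pk.2.+1)
    else (set_nth 0 row i y :: rest, 0)
  else ([:: [:: y]], 0).

Definition insw (lt : rel nat) (P : tab) (w : seq nat) : tab :=
  foldl (fun P y => (ins lt P y).1) P w.

Definition ishape (w : seq nat) : seq nat := map size (insw leq [::] w).

Lemma insw_cons lt R P w :
  (* The upper rows see only the word bumped out of the first one. Insertion can thus be carried out
     row by row, which allows inductions on the length of the word. *)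
  insw lt (R :: P) w = (row_pass lt R w).1 :: insw lt P (row_pass lt R w).2.
Proof.
elim: w R P => [|y w IH] R P //=.
case: ifP => h /=; by rewrite -/(insw _ _ _) IH.
Qed.

Lemma insw_nil lt w : w != [::] ->
  insw lt [::] w = (row_pass lt [::] w).1 :: insw lt [::] (row_pass lt [::] w).2.
Proof. by case: w => // y w _; rewrite /insw /= -/(insw _ _ _) insw_cons. Qed.

Lemma row_pass_cat lt R w1 w2 :
  row_pass lt R (w1 ++ w2) =
  ((row_pass lt (row_pass lt R w1).1 w2).1,
   (row_pass lt R w1).2 ++ (row_pass lt (row_pass lt R w1).1 w2).2).
Proof.
elim: w1 R => [|y w1 IH] R /=; first by case: row_pass.
by rewrite IH /=; case: ifP.
Qed.

Lemma row_pass_cat1 lt R w1 w2 :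
  (row_pass lt R (w1 ++ w2)).1 = (row_pass lt (row_pass lt R w1).1 w2).1.
Proof. by rewrite row_pass_cat. Qed.

Lemma row_pass_cat2 lt R w1 w2 :
  (row_pass lt R (w1 ++ w2)).2 = (row_pass lt R w1).2 ++ (row_pass lt (row_pass lt R w1).1 w2).2.
Proof. by rewrite row_pass_cat. Qed.

Lemma row_pass_bump L x M y w : all (ltn y) L -> x <= y ->
  row_pass leq (L ++ x :: M) (y :: w) =
  ((row_pass leq (L ++ y :: M) w).1, x :: (row_pass leq (L ++ y :: M) w).2).
Proof.
move=> hL hx /=.
have -> : find (leq^~ y) (L ++ x :: M) = size L.
  rewrite find_cat /= hx addn0.
  by case: hasP => // -[z zL]; move/allP/(_ _ zL): hL; rewrite /= ltnNge => /negP.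
rewrite size_cat /= -ltn_subLR // subnn /= nth_cat ltnn subnn /=.
suff -> : set_nth 0 (L ++ x :: M) (size L) y = L ++ y :: M by [].
by elim: L {hL} => //= a L ->.
Qed.

Lemma row_pass_app R y w : all (ltn y) R ->
  row_pass leq R (y :: w) = row_pass leq (rcons R y) w.
Proof.
move=> hR /=.
have hh : has (leq^~ y) R = false.
  apply/hasP => -[z zR]; move/allP/(_ _ zR): hR; rewrite /= ltnNge => /negP //.
have -> : find (leq^~ y) R = size R by apply: hasNfind; rewrite hh.
rewrite ltnn /=.
suff -> : set_nth 0 R (size R) y = rcons R y by case: row_pass.
by elim: R {hR hh} => //= a L ->.
Qed.

Variant row_split (y : nat) : seq nat -> Type :=
| RowApp R of all (ltn y) R : row_split y R
| RowBump L x M of all (ltn y) L & x <= y : row_split y (L ++ x :: M).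

Lemma row_splitP y R : row_split y R.
Proof.
elim: R => [|a R IH]; first exact: RowApp.
have [ay|ya] := leqP a y; first exact: (@RowBump y [::] a R).
case: IH => [R' h|L x M h xy]; first by apply: RowApp; rewrite /= ya.
by apply: (@RowBump y (a :: L) x M) => //=; rewrite ya.
Qed.

Lemma sorted_app R y : sorted gtn R -> all (ltn y) R -> sorted gtn (rcons R y).
Proof.
rewrite !(sorted_pairwise gtn_trans) pairwise_rcons => -> h.
by rewrite andbT; apply: sub_all h => z.
Qed.

Lemma sorted_bump L x M y : sorted gtn (L ++ x :: M) -> all (ltn y) L -> x <= y ->
  sorted gtn (L ++ y :: M).
Proof.
rewrite !(sorted_pairwise gtn_trans) !pairwise_cat /=.
case/and3P=> /allrelP h1 -> /andP[/allP h2 ->] hL xy; rewrite !andbT /=.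
apply/andP; split.
  apply/allrelP => a b aL; rewrite inE => /orP[/eqP->|bM].
    by move/allP/(_ _ aL): hL.
  by apply: h1 => //; rewrite inE bM orbT.
by apply/allP => b /h2 /=; lia.
Qed.

Lemma row_pass_sorted R w : sorted gtn R -> sorted gtn (row_pass leq R w).1.
Proof.
elim: w R => [|y w IH] R // sR.
case: (row_splitP y R) sR => [{}R hR|L x M hL xy] sR.
  by rewrite row_pass_app //; apply/IH/sorted_app.
by rewrite row_pass_bump //=; apply/IH/(sorted_bump sR).
Qed.

Lemma row_pass_perm R w : perm_eq (R ++ w) ((row_pass leq R w).2 ++ (row_pass leq R w).1).
Proof.
elim: w R => [|y w IH] R; first by rewrite cats0.
case: (row_splitP y R) => [{}R hR|L x M hL xy].
  by rewrite row_pass_app // -cat_rcons; apply: IH.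
rewrite row_pass_bump //= perm_sym.
apply: perm_trans (_ : perm_eq (x :: ((L ++ y :: M) ++ w)) _).
  by rewrite perm_cons perm_sym; apply: IH.
by apply/permP => a; rewrite /= !count_cat /=; lia.
Qed.

(** * Bracketing *)

(* Words in the letters c, c+1 with (c+1) c = 1 form the bicyclic monoid:
   the pair (u, v) stands for c^u (c+1)^v. *)
Definition bmul (a b : nat * nat) : nat * nat :=
  (a.1 + (b.1 - a.2), b.2 + (a.2 - b.1)).

Definition bgen (c x : nat) : nat * nat := (nat_of_bool (x == c), nat_of_bool (x == c.+1)).

Definition bracket (c : nat) (w : seq nat) : nat * nat :=
  foldr (fun x => bmul (bgen c x)) (0, 0) w.

Lemma bmulA a b d : bmul a (bmul b d) = bmul (bmul a b) d.
Proof. by case: a b d => [a1 a2] [b1 b2] [d1 d2]; rewrite /bmul /=; congr pair; lia. Qed.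

Lemma bmul1 a : bmul a (0, 0) = a.
Proof. by case: a => a1 a2; rewrite /bmul /=; congr pair; lia. Qed.

Lemma b1mul a : bmul (0, 0) a = a.
Proof. by case: a => a1 a2; rewrite /bmul /=; congr pair; lia. Qed.

Lemma bracket_cons c x w : bracket c (x :: w) = bmul (bgen c x) (bracket c w).
Proof. by []. Qed.

Lemma bracket_cat c w1 w2 : bracket c (w1 ++ w2) = bmul (bracket c w1) (bracket c w2).
Proof.
elim: w1 => [|x w IH]; first by rewrite b1mul.
by rewrite cat_cons !bracket_cons IH bmulA.
Qed.

Lemma bracket_sorted c R : sorted gtn R ->
  bracket c R = (nat_of_bool ((c \in R) && (c.+1 \notin R)),
            nat_of_bool ((c.+1 \in R) && (c \notin R))).
Proof.
elim: R => // x R IH; rewrite /= (path_sortedE gtn_trans) => /andP[hx sR].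
rewrite IH // !inE /bgen.
have hn z : x <= z -> z \in R = false.
  by move=> xz; apply/negP => /(allP hx) /=; lia.
move: (hn c) (hn c.+1); rewrite /bmul /=.
by case: (c \in R); case: (c.+1 \in R) => h1 h2 /=; congr pair; lia.
Qed.

(** A bump is a plactic move: the row followed by [y] becomes the bumped letter followed by the new
    row. Only c and c+1 count, and a strictly decreasing row contains each at most once, so a finite
    check suffices. *)
Lemma bracket_swap c L x M y : sorted gtn (L ++ x :: M) -> all (ltn y) L -> x <= y ->
  bracket c ((L ++ x :: M) ++ [:: y]) = bracket c (x :: L ++ y :: M).
Proof.
rewrite (sorted_pairwise gtn_trans) pairwise_cat /=.
case/and3P=> /allrelP h1 pL /andP[/allP h2 pM] /allP hL xy.
rewrite -catA cat_cons !(bracket_cat, bracket_cons) (@bracket_sorted c L) ?(sorted_pairwise gtn_trans) //.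
rewrite (@bracket_sorted c M) ?(sorted_pairwise gtn_trans) //.
have e1 z : z <= y -> z \in L = false by move=> zy; apply/negP => /hL /=; lia.
have e2 z : x <= z -> z \in M = false by move=> xz; apply/negP => /h2 /=; lia.
have [m1 m2 m3 m4] : [/\ c <= y -> c \in L = false, c.+1 <= y -> c.+1 \in L = false,
   x <= c -> c \in M = false & x <= c.+1 -> c.+1 \in M = false].
  by split; auto.
rewrite /bmul /bgen /=; move: (c \in L) (c.+1 \in L) (c \in M) (c.+1 \in M) m1 m2 m3 m4.
case: (eqVneq y c) => y1; case: (eqVneq y c.+1) => y2; try lia;
case: (eqVneq x c) => x1; case: (eqVneq x c.+1) => x2; try lia;
by move=> [] [] [] [] m1 m2 m3 m4 //=; exfalso; clear -xy y1 y2 x1 x2 m1 m2 m3 m4; lia.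
Qed.

Arguments row_pass : simpl never.

Lemma row_pass_br c R w : sorted gtn R ->
  bracket c (R ++ w) = bracket c ((row_pass leq R w).2 ++ (row_pass leq R w).1).
Proof.
elim: w R => [|y w IH] R sR; first by rewrite cats0.
case: (row_splitP y R) sR => [{}R hR|L x M hL xy] sR.
  by rewrite row_pass_app // -cat_rcons; apply/IH/sorted_app.
rewrite row_pass_bump // cat_cons bracket_cons -IH; last exact: sorted_bump sR _ _.
have -> : (L ++ x :: M) ++ y :: w = ((L ++ x :: M) ++ [:: y]) ++ w by rewrite -(catA _ [:: y]).
by rewrite bracket_cat bracket_swap // bracket_cons -bmulA -bracket_cat.
Qed.

Lemma bracket_prefix c w1 w2 : (bracket c (w1 ++ w2)).1 = 0 -> (bracket c w1).1 = 0.
Proof. by rewrite bracket_cat /=; lia. Qed.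

(** The bumped word is a prefix of the invariant reading word, and an unmatched c of a prefix stays
    unmatched. *)
Lemma bracket_bumped c R w : sorted gtn R -> (bracket c (R ++ w)).1 = 0 ->
  (bracket c (row_pass leq R w).2).1 = 0.
Proof. by move=> sR; rewrite row_pass_br // => /bracket_prefix. Qed.

(** What becomes of a difference c+1 against c after one row: either the row absorbs it, or the
    bumped words inherit it as one letter. In the second case [d], the bracket of what is bumped
    before that letter, and the condition on [Y] are what is needed to show that the letter is again
    the leftmost unmatched c+1. *)
Definition linked c (d : nat * nat) (RB1 RB2 : seq nat * seq nat) : Prop :=
  (RB1.2 = RB2.2 /\ size RB1.1 = size RB2.1) \/
  (RB1.1 = RB2.1 /\ exists X Y,
     [/\ RB1.2 = X ++ c.+1 :: Y, RB2.2 = X ++ c :: Y, bracket c X = d & (bracket c Y).1 = 0]).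

Lemma linked_cons c d x RB1 RB2 : linked c d RB1 RB2 ->
  linked c (bmul (bgen c x) d) (RB1.1, x :: RB1.2) (RB2.1, x :: RB2.2).
Proof.
case=> [[h1 h2]|[h1 [X [Y [e1 e2 e3 e4]]]]]; [left|right]; split=> //=; first by rewrite h1.
by exists (x :: X), Y; split; rewrite ?e1 ?e2 // bracket_cons e3.
Qed.

Lemma linked_now c RB : (bracket c RB.2).1 = 0 ->
  linked c (0, 0) (RB.1, c.+1 :: RB.2) (RB.1, c :: RB.2).
Proof. by move=> h; right; split=> //; exists [::], RB.2. Qed.

(** The two rows keep their different entry until a letter bumps it from both, after which they
    agree. The only letter that would act differently is c, and it cannot come before a c+1, since
    it would be an unmatched c of [w]. *)
Lemma linked_row c L M w :
  sorted gtn (L ++ c.+1 :: M) -> c \notin M -> (bracket c w).1 = 0 ->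
  linked c (0, 0) (row_pass leq (L ++ c.+1 :: M) w) (row_pass leq (L ++ c :: M) w).
Proof.
elim: w L M => [|y w IH] L M sR cM hw; first by left; rewrite !size_cat.
have := sR; rewrite (sorted_pairwise gtn_trans) pairwise_cat /=.
case/and3P=> /allrelP hLM _ /andP[/allP hM _].
have hL z : z \in L -> c.+1 < z by move=> zL; apply: hLM => //; rewrite inE eqxx.
have {}hM z : z \in M -> z < c.
  move=> zM; have /= := hM _ zM; have : z != c by apply: contraNneq cM => <-.
  lia.
have eL z : z <= c.+1 -> z \in L = false.
  by move=> zc; apply/negP => /hL; rewrite ltnNge zc.
have eM z : c <= z -> z \in M = false.
  by move=> zc; apply/negP => /hM; rewrite ltnNge zc.
move: hw; rewrite bracket_cons /bgen.
have [->|yc] := eqVneq y c; first by rewrite /bmul /=; lia.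
have [->|yc1] := eqVneq y c.+1 => hw.
  have aL : all (ltn c.+1) L by apply/allP.
  (* The rest of the word may have an unmatched c, whose partner was this c+1. The row now holds c+1
     without c and supplies the partner again. *)
  rewrite !row_pass_bump //; apply: linked_now; apply: bracket_bumped => //.
  rewrite bracket_cat bracket_sorted // !mem_cat !inE !eqxx eL // eM // /= orbT.
  by rewrite (ltn_eqF (ltnSn c)).
rewrite b1mul in hw.
have [ylt|ygt] := ltnP y c.
  case: (row_splitP y M) sR cM hM {hLM eM} => [{}M aM|M1 x M2 aM xy] sR cM hM.
    have aL d : c <= d -> all (ltn y) (L ++ d :: M).
      move=> cd; rewrite all_cat /= aM (leq_trans ylt cd) !andbT.
      by apply/allP => z /hL /=; lia.
    rewrite !row_pass_app ?aL //.
    rewrite !rcons_cat /=; apply: IH => //.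
      by have := @sorted_app (L ++ c.+1 :: M) y sR; rewrite rcons_cat; apply; apply: aL.
    by rewrite mem_rcons inE negb_or eq_sym yc.
  have aL d : c <= d -> all (ltn y) (L ++ d :: M1).
    move=> cd; rewrite all_cat /= aM (leq_trans ylt cd) !andbT.
    by apply/allP => z /hL /=; lia.
  rewrite -!cat_cons !catA !row_pass_bump ?aL //.
  have xc : x < c by apply: hM; rewrite mem_cat inE eqxx orbT.
  have -> : (0, 0) = bmul (bgen c x) (0, 0).
    by rewrite bmul1 /bgen !ltn_eqF // ltnW.
  apply: linked_cons; rewrite -!catA !cat_cons; apply: IH => //.
    have := @sorted_bump (L ++ c.+1 :: M1) x M2 y.
    by rewrite -!catA !cat_cons; apply => //; rewrite ?aL.
  move: cM; rewrite !mem_cat !inE !negb_or => /and3P[-> _ ->].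
  by rewrite eq_sym yc.
case: (row_splitP y L) sR hL eL {hLM} => [{}L aL|L1 x L2 aL xy] sR hL eL.
  rewrite !row_pass_bump //; try lia.
  apply: linked_now; apply: bracket_bumped; first by apply: (sorted_bump sR) => //; lia.
  rewrite bracket_cat bracket_sorted; last by apply: (sorted_bump sR) => //; lia.
  rewrite !mem_cat !inE !eL // !eM // (eq_sym c) (eq_sym c.+1).
  by rewrite (negPf yc) (negPf yc1) b1mul.
have xc : c.+1 < x by apply: hL; rewrite mem_cat inE eqxx orbT.
rewrite -!catA !cat_cons !row_pass_bump //.
have -> : (0, 0) = bmul (bgen c x) (0, 0).
  by rewrite bmul1 /bgen !gtn_eqF // ltnW.
apply: linked_cons; have := @IH (L1 ++ y :: L2) M; rewrite -!catA !cat_cons; apply => //.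
by apply: (sorted_bump (x := x)) => //; move: sR; rewrite -catA.
Qed.

(** By hypothesis the row does not contain c+1 without c. If c+1 is absent, both letters go to the
    same place and [linked_row] takes over. If c+1 and c are both present they are adjacent, each
    letter replaces its own copy, the row does not change, and the bumped letters are again c+1 and
    c. *)
Lemma linked_letter c R w :
  sorted gtn R -> (bracket c R).2 = 0 -> (bracket c w).1 = 0 ->
  linked c (bracket c R) (row_pass leq R (c.+1 :: w)) (row_pass leq R (c :: w)).
Proof.
move=> sR; have := bracket_sorted c sR; case: (row_splitP c R) sR => [{}R aR|L x M aL xc] sR.
  have eR z : z <= c -> z \in R = false.
    by move=> zc; apply/negP => /(allP aR) /=; lia.
  rewrite eR // /= andbT => -> /=; case: (boolP (_ \in R)) => // c1R _ hw.
  have aR1 : all (ltn c.+1) R.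
    apply/allP => z zR; have /= := allP aR _ zR.
    have : z != c.+1 by apply: contraNneq c1R => <-.
    lia.
  rewrite !row_pass_app // -!cats1; apply: linked_row => //.
  by rewrite cats1; apply: sorted_app.
move=> hbr h0 hw.
have := sR; rewrite (sorted_pairwise gtn_trans) pairwise_cat /=.
case/and3P=> /allrelP hLM _ /andP[/allP hM _].
have eL z : z <= c -> z \in L = false.
  by move=> zc; apply/negP => /(allP aL) /=; lia.
have eM z : x <= z -> z \in M = false.
  by move=> zc; apply/negP => /hM /=; lia.
have brR : bracket c (L ++ x :: M) = (nat_of_bool ((x == c) && (c.+1 \notin L)), 0).
  move: hbr h0; rewrite !mem_cat !inE (eL c) // !(eM c.+1) ?(eM c); try lia.
  rewrite (gtn_eqF (_ : x < c.+1)) // (eq_sym c) /= !orbF => ->.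
  by rewrite /= => ->.
have {}h0 : c.+1 \in L -> x = c.
  move: h0; rewrite hbr /= !mem_cat !inE (eL c) // (eM c) //= => h cL.
  by move: h; rewrite cL /= orbF eq_sym; case: eqP.
rewrite brR.
case: (boolP (c.+1 \in L)) => c1L; last first.
  have aL1 : all (ltn c.+1) L.
    apply/allP => z zL; have /= := allP aL _ zL.
    have : z != c.+1 by apply: contraNneq c1L => <-.
    lia.
  rewrite andbT !row_pass_bump //; last lia.
  have -> : (nat_of_bool (x == c), 0) = bmul (bgen c x) (0, 0).
    by rewrite bmul1 /bgen (ltn_eqF (_ : x < c.+1)).
  apply: linked_cons; apply: linked_row => //; last by rewrite eM.
  by apply: (sorted_bump sR) => //; lia.
have xE := h0 c1L; subst x; rewrite eqxx /=.
case/splitPr: c1L sR hLM aL eL {hbr brR h0} => L1 L2 sR hLM aL eL.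
have L20 : L2 = [::].
  case: L2 sR hLM aL eL => // z L2 sR _ aL _.
  move: sR; rewrite (sorted_pairwise gtn_trans) !pairwise_cat /=.
  case/and3P=> _ /and3P[_ _ /andP[/andP[zc _] _]] _.
  by move: aL; rewrite all_cat /= => /and4P[_ _ cz _]; lia.
subst L2.
have aL1 : all (ltn c.+1) L1.
  move: sR; rewrite (sorted_pairwise gtn_trans) !pairwise_cat /=.
  case/and3P=> _ /and3P[/allrelP h _ _] _.
  by apply/allP => z zL; apply: h => //; rewrite inE eqxx.
rewrite -catA cat_cons /= row_pass_bump //.
have -> : L1 ++ c.+1 :: c :: M = (L1 ++ [:: c.+1]) ++ c :: M by rewrite -catA.
rewrite row_pass_bump //; apply: linked_now; apply: bracket_bumped => //.
rewrite bracket_cat bracket_sorted // !mem_cat !inE !eqxx !orbT /=.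
by rewrite subn0.
Qed.

Lemma row_pass_head R w : sorted gtn R ->
  all (geq (head 0 (row_pass leq R w).1)) (R ++ w).
Proof.
elim: w R => [|y w IH] R sR.
  rewrite cats0; case: R sR => //= x R; rewrite (path_sortedE gtn_trans) leqnn.
  by case/andP=> h _; apply: sub_all h => z /=; lia.
case: (row_splitP y R) sR => [{}R aR|L x M aL xy] sR.
  rewrite row_pass_app // -cat_rcons; apply: IH; exact: sorted_app.
rewrite row_pass_bump //=.
have := IH _ (sorted_bump sR aL xy); rewrite !all_cat /= => /andP[/and3P[-> hy ->] ->].
by rewrite hy /= !andbT; apply: leq_trans hy.
Qed.

Lemma row_pass_size R w : size (row_pass leq R w).2 + size (row_pass leq R w).1 = size R + size w.
Proof. by have /perm_size := row_pass_perm R w; rewrite !size_cat. Qed.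

Lemma row_pass_size_row R w : size R <= size (row_pass leq R w).1.
Proof.
elim: w R => [|y w IH] R //; case: (row_splitP y R) => [{}R aR|L x M aL xy].
  by rewrite row_pass_app //; apply: leq_trans (IH _); rewrite size_rcons.
by rewrite row_pass_bump //=; apply: leq_trans (IH _); rewrite !size_cat.
Qed.

Lemma row_pass_bumped_size w : w != [::] -> size (row_pass leq [::] w).2 < size w.
Proof.
case: w => [//|y w] _; rewrite row_pass_app //.
have := row_pass_size [:: y] w; have := row_pass_size_row [:: y] w; rewrite /=; lia.
Qed.

Lemma ishape_rec w : w != [::] ->
  ishape w = size (row_pass leq [::] w).1 :: ishape (row_pass leq [::] w).2.
Proof. by move=> w0; rewrite /ishape insw_nil. Qed.

(* Lowering the leftmost unmatched c+1 of a word is coplactic. *)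
Lemma ishape_lower c A S : (bracket c A).2 = 0 -> (bracket c S).1 = 0 ->
  ishape (A ++ c.+1 :: S) = ishape (A ++ c :: S).
Proof.
have [n] := ubnP (size A + size S); elim: n A S => // n IH A S hn hA hS.
rewrite !(@ishape_rec (A ++ _)); try by case: (A).
rewrite !row_pass_cat1 !row_pass_cat2.
have sR : sorted gtn (row_pass leq [::] A).1 by apply: row_pass_sorted.
have := @row_pass_br c [::] A isT; rewrite cat0s bracket_cat => hbr.
have hbR : (bracket c (row_pass leq [::] A).1).2 = 0 by move: hA; rewrite hbr /=; lia.
case: (linked_letter sR hbR hS) => [[-> ->] //|[-> [X [Y [e1 e2 e3 e4]]]]].
(* [X] has the bracket of the row left by [A], so what is bumped by [A] followed by [X] has the
   bracket of [A]: the hypotheses pass to the next row. *)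
congr (_ :: _); rewrite e1 e2 !catA; apply: IH => //; last by rewrite bracket_cat e3 -hbr.
have := @row_pass_bumped_size (A ++ c :: S); rewrite row_pass_cat2 e2.
have -> : A ++ c :: S != [::] by case: (A).
move=> /(_ isT); rewrite /= !size_cat /=; lia.
Qed.

Lemma down_closed_iota R : sorted gtn R -> 0 \notin R ->
  (forall c, 0 < c -> c.+1 \in R -> c \in R) ->
  perm_eq R (iota 1 (head 0 R)).
Proof.
move=> sR R0 dc.
have uR : uniq R by apply: sorted_uniq sR; [exact: gtn_trans | move=> x /=; rewrite ltnn].
apply: uniq_perm => //; first exact: iota_uniq.
case: R sR R0 dc {uR} => //= m R; rewrite (path_sortedE gtn_trans) => /andP[/allP hm _] R0 dc c.
rewrite mem_iota add1n ltnS; apply/idP/idP => [cR|/andP[c0 cm]].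
  apply/andP; split; first by case: c cR R0 => // ->.
  by move: cR; rewrite inE => /orP[/eqP-> //|/hm /=]; lia.
have : forall d, d < m -> m - d \in m :: R.
  elim=> [|d IH] dm; first by rewrite subn0 inE eqxx.
  by apply: dc; [lia | rewrite (_ : (m - d.+1).+1 = m - d) ?IH; lia].
by move/(_ (m - c)); rewrite subKn //; apply; lia.
Qed.

(** The bottom row inherits the absence of unmatched c+1, so it is closed under c+1 -> c and reads
    m, ..., 2, 1: it takes one copy of every letter that occurs. Below m it is neutral for the
    bracketing, hence the bumped word satisfies the same hypotheses. Here [count (leq c)] of a shape
    is the length of its column c, counted from 1. *)
Lemma ishape_yamanouchi w :
  0 \notin w -> (forall c, 0 < c -> (bracket c w).2 = 0) ->
  [/\ sorted geq (ishape w), all (geq (head 0 (ishape w))) w &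
      forall c, 0 < c -> count (leq c) (ishape w) = count_mem c w].
Proof.
have [n] := ubnP (size w); elim: n w => // n IH w hn w0 hw.
have [->//|wn] := eqVneq w [::].
have hsz := row_pass_bumped_size wn.
have sR : sorted gtn (row_pass leq [::] w).1 by apply: row_pass_sorted.
have hd := @row_pass_head [::] w isT; have pm := row_pass_perm [::] w.
have hb c := @row_pass_br c [::] w isT.
rewrite ishape_rec //; case: (row_pass leq [::] w) hsz sR hd pm hb => R B /= hsz sR hd pm hb.
have B0 : 0 \notin B.
  by apply: contra w0; rewrite (perm_mem pm) mem_cat => ->.
have R0 : 0 \notin R.
  by apply: contra w0; rewrite (perm_mem pm) mem_cat => ->; rewrite orbT.
have dc c : 0 < c -> c.+1 \in R -> c \in R.
  move=> c0 cR; have := hw c c0; rewrite hb bracket_cat (@bracket_sorted c R) //= cR /=.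
  by case: (c \in R) => //=; lia.
have pR := down_closed_iota sR R0 dc.
have sz : size R = head 0 R by rewrite (perm_size pR) size_iota.
have mR c : 0 < c -> (c \in R) = (c <= size R).
  by move=> c0; rewrite (perm_mem pR) mem_iota -sz; lia.
have hB : all (geq (size R)) B.
  by move: hd; rewrite -sz (perm_all _ pm) all_cat => /andP[].
have [|s1 s2 s3] := IH B (leq_trans hsz hn) B0.
  move=> c c0; have := hw c c0; rewrite hb bracket_cat (@bracket_sorted c R) //= !mR //.
  have [lt|le] := ltnP c (size R).
    by rewrite (ltnW lt) /=; lia.
  move=> _; have : (bracket c B).2 <= count_mem c.+1 B.
    elim: (B) => //= x B' IHB; rewrite /bmul /bgen /=; lia.
  rewrite (count_memPn _); first by case: (_.2).
  by apply/negP => /(allP hB) /=; lia.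
split.
- rewrite /=; case: (ishape B) s1 s3 s2 => //= b sh s1 s3 s2; rewrite s1 andbT.
  case: b s3 {s1 s2} => [//|b] /(_ b.+1 isT); rewrite leqnn add1n => hc.
  have bB : b.+1 \in B by rewrite -has_pred1 has_count -hc.
  exact: (allP hB _ bB).
- by rewrite /= sz.
move=> c c0; rewrite /= s3 // (permP pm) count_cat (permP pR).
by rewrite (count_uniq_mem _ (iota_uniq _ _)) mem_iota -sz add1n ltnS c0 addnC.
Qed.

(** * Standardization and the recording tableau *)

Lemma std_size w : size (std w) = size w.
Proof. by rewrite size_map size_iota. Qed.

Lemma nth_std w i : i < size w ->
  nth 0 (std w) i =
  (count (fun y => y < nth 0 w i) w + count (pred1 (nth 0 w i)) (take i w)).+1.
Proof. by move=> iw; rewrite (nth_map 0) ?size_iota // nth_iota. Qed.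

Lemma count_take_lt (a : pred nat) w i j : i < j -> j <= size w -> a (nth 0 w i) ->
  count a (take i w) < count a (take j w).
Proof.
move=> ij jw ai; rewrite -(subnKC ij) takeD count_cat (take_nth 0) ?(leq_trans ij) //.
by rewrite -cats1 count_cat /= ai addn0 addn1 ltn_addr.
Qed.

Lemma std_cmp w i j : i < j -> j < size w ->
  if nth 0 w i <= nth 0 w j then nth 0 (std w) i < nth 0 (std w) j
  else nth 0 (std w) j < nth 0 (std w) i.
Proof.
move=> ij jw; have iw : i < size w by apply: ltn_trans jw.
rewrite !nth_std // !ltnS.
have split_le x : count (fun y => y < x) w + count (pred1 x) w = count (fun y => y <= x) w.
  rewrite -count_predUI addnC (eq_count (a2 := pred0)) => [|y /=]; last by lia.
  by rewrite count_pred0 add0n; apply: eq_count => y /=; lia.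
have strict k x : k < size w -> nth 0 w k < x ->
    count (fun y => y < nth 0 w k) w + count (pred1 (nth 0 w k)) (take k w) <
    count (fun y => y < x) w.
  move=> kw kx; apply: leq_trans (_ : count (fun y => y <= nth 0 w k) w <= _).
    have := @count_take_lt (pred1 (nth 0 w k)) w k (size w) kw (leqnn _) (eqxx _).
    by rewrite take_size -split_le ltn_add2l.
  by apply: sub_count => y /=; lia.
case: (ltngtP (nth 0 w i) (nth 0 w j)) => h.
- by apply: leq_trans (strict _ _ iw h) (leq_addr _ _).
- by apply: leq_trans (strict _ _ jw h) (leq_addr _ _).
by rewrite -h ltn_add2l; apply: count_take_lt => //=; lia.
Qed.

Lemma std_uniq w : uniq (std w).
Proof.
apply/(uniqP 0) => i j; rewrite !inE std_size => iw jw e.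
by case: (ltngtP i j) => // h; have := std_cmp h ltac:(eassumption); rewrite e !ltnn if_same.
Qed.

Definition unstd (w : seq nat) (v : nat) : nat := nth 0 w (index v (std w)).

Lemma map_unstd w : map (unstd w) (std w) = w.
Proof.
apply: (@eq_from_nth _ 0); rewrite size_map std_size // => i iw.
by rewrite (nth_map 0) ?std_size // /unstd index_uniq ?std_size ?std_uniq.
Qed.

(** Meant for [a] standing to the left of [b]: strict comparison of the standard letters is weak
    comparison of the original ones. As it depends on the order of the letters, it has to be
    maintained on the reading word during insertion. *)
Definition std_rel (f : nat -> nat) (a b : nat) : bool := (a < b) == (f a <= f b).

Lemma std_pairwise w : pairwise (std_rel (unstd w)) (std w).
Proof.
apply/(pairwiseP 0) => i j; rewrite !inE std_size => iw jw ij.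
rewrite /std_rel /unstd !index_uniq ?std_size ?std_uniq //.
have := std_cmp ij jw; case: ifP => // _; lia.
Qed.

Definition rword (P : tab) : seq nat := flatten (rev P).

Lemma rword_cons row P : rword (row :: P) = rword P ++ row.
Proof. by rewrite /rword rev_cons -cats1 flatten_cat /= cats0. Qed.

(** A bump reverses only the pairs of [L] with [x] and of [M] with [y]. For these the original
    letters must differ strictly: for m in [M] this follows from f m < f x <= f y. *)
Lemma std_rel_swap f A L x M y tl :
  sorted gtn (L ++ x :: M) -> all (leq y) L -> x < y ->
  pairwise (std_rel f) (A ++ (L ++ x :: M) ++ y :: tl) ->
  pairwise (std_rel f) (A ++ x :: (L ++ y :: M) ++ tl).
Proof.
rewrite (sorted_pairwise gtn_trans) pairwise_cat allrel_consr /=.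
case/and4P=> /andP[/allP Lx _] _ /allP Mx _ /allP Ly xy.
rewrite !(pairwise_cat, pairwise_cons, allrel_catl, allrel_catr, allrel_consl, allrel_consr, all_cat) /=.
have i1 : all ((std_rel f)^~ x) L -> all (std_rel f x) L.
  move=> /allP h; apply/allP => a aL; move: (h _ aL) (Lx _ aL); rewrite /std_rel /=; lia.
have i2 : all (std_rel f x) M -> std_rel f x y -> all (std_rel f y) M.
  move=> /allP h hxy; apply/allP => a aM.
  move: (h _ aM) (Mx _ aM) hxy; rewrite /std_rel /=; lia.
case/and5P => /and3P[/and3P[-> -> ->] -> ->] ->.
case/and4P=> /andP[-> ->] /andP[hxy ->] _ ->.
case/and4P=> /andP[/i1 -> ->] -> h -> /andP[-> ->].
by rewrite hxy h (i2 h hxy).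
Qed.

Lemma set_nth_size (T : Type) (x0 : T) s y : set_nth x0 s (size s) y = rcons s y.
Proof. by elim: s => //= a s ->. Qed.

Lemma set_nth_mid (T : Type) (x0 : T) L x M y :
  set_nth x0 (L ++ x :: M) (size L) y = L ++ y :: M.
Proof. by elim: L => //= a L ->. Qed.

Lemma maxn_dom x s : all (ltn^~ x) s -> foldr maxn 0 (x :: s) = x.
Proof.
move=> h; apply/maxn_idPl => /=.
by elim: s h => //= a s IH /andP[ax /IH h]; rewrite geq_max h ltnW.
Qed.

(** The word consists of the tableau, the letter being inserted, and a tail. In the recursive call
    the tail also takes in the row just completed, since the bumped letter has moved to its left. *)
Lemma ins_std f P y tl :
  pairwise (std_rel f) (rword P ++ y :: tl) -> all (sorted gtn) P ->
  [/\ ins leq (map (map f) P) (f y) =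
        (map (map f) (ins ltn P y).1, (ins ltn P y).2),
      pairwise (std_rel f) (rword (ins ltn P y).1 ++ tl),
      all (sorted gtn) (ins ltn P y).1 &
      rs_ins P y = ins ltn P y].
Proof.
elim: P y tl => [|row P IH] y tl //=.
rewrite rword_cons -catA => pw /andP[sr sP].
have hrow x : x \in row -> (x < y) = (f x <= f y).
  move=> xr; move: pw; rewrite !pairwise_cat /=.
  case/and3P=> _ _ /and3P[/allrelP h _ _].
  exact: eqP (h x y xr (mem_head _ _)).
have efind : find (leq^~ (f y)) (map f row) = find (ltn^~ y) row.
  rewrite find_map; apply: eq_in_find => x xr /=; by rewrite -hrow.
rewrite efind size_map; set i := find _ row.
case: ifP => irow; last first.
  have {}irow : i = size row by apply/eqP; rewrite eqn_leq find_size leqNgt irow.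
  have hall : all (leq y) row.
    have : ~~ has (ltn^~ y) row by rewrite has_find -/i irow ltnn.
    by rewrite -all_predC; apply: sub_all => z /=; rewrite -leqNgt.
  have -> : [seq x <- row | x < y] = [::].
    by rewrite (eq_in_filter (a2 := pred0)) ?filter_pred0 // => z /(allP hall) /=; lia.
  have {}hall : all (ltn y) row.
    apply/allP => z zr; rewrite /= ltn_neqAle (allP hall _ zr) andbT.
    by apply/eqP => e; move: (hrow z zr); rewrite -e ltnn leqnn.
  rewrite irow -[X in set_nth _ (map f row) X](size_map f) !set_nth_size.
  split=> //; rewrite /= ?map_rcons ?rword_cons //=.
    by rewrite -cats1 -!catA.
  by rewrite sP andbT; apply: sorted_app.
rewrite (nth_map 0) //; have := erefl row; rewrite -{1}(cat_take_drop i row) (drop_nth 0) //.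
have xy : nth 0 row i < y by apply: (@nth_find _ 0 (ltn^~ y)); rewrite has_find.
have Ly : all (leq y) (take i row).
  apply/(all_nthP 0) => k; rewrite size_takel ?(ltnW irow) // => ki.
  by rewrite nth_take // leqNgt; apply/negP => h; have := before_find 0 ki; rewrite /= h.
have sL : size (take i row) = i by rewrite size_takel // ltnW.
move: (nth 0 row i) (take i row) (drop i.+1 row) xy Ly sL => x L M xy Ly sL e.
rewrite -e in sr pw hrow *.
move/(std_rel_swap sr Ly xy): pw => pw.
have [-> IH2 IH3 IH4] := IH _ _ pw sP.
rewrite -sL -[X in set_nth _ (map f _) X](size_map f) map_cat /= !set_nth_mid.
have Mx : all (ltn^~ x) M.
  move: sr; rewrite (sorted_pairwise gtn_trans) pairwise_cat /=.
  by case/and4P.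
have -> : [seq z <- L ++ x :: M | z < y] = x :: M.
  rewrite filter_cat /= xy (eq_in_filter (a2 := pred0)).
    rewrite filter_pred0 cat0s; congr (_ :: _); apply/all_filterP.
    by apply: sub_all Mx => z /=; lia.
  by move=> z /(allP Ly) /=; lia.
rewrite maxn_dom //.
have -> : index x (L ++ x :: M) = size L.
  rewrite index_cat /= eqxx addn0 ifN //.
  by apply/negP => /(allP Ly) /=; lia.
rewrite set_nth_mid IH4; split=> //=.
- by rewrite map_cat.
- by rewrite rword_cons -catA.
- rewrite IH3 andbT; move: sr; rewrite !(sorted_pairwise gtn_trans) !pairwise_cat /=.
  rewrite !allrel_consr => /and4P[/andP[_ ->] -> _ ->]; rewrite /= !andbT.
  apply/andP; split; last by apply: sub_all Mx => z /=; lia.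
  apply/allP => z zL /=; have /= := allP Ly _ zL; rewrite leq_eqVlt => /orP[/eqP ey|//].
  have := hrow z; rewrite mem_cat zL -ey ltnn => /(_ isT).
  by rewrite leqnn.
- by case: (ins ltn P x).
Qed.

Fixpoint ridx (lt : rel nat) (P : tab) (w : seq nat) : seq nat :=
  if w is y :: w' then (ins lt P y).2 :: ridx lt (ins lt P y).1 w' else [::].

Fixpoint qrec (Q : tab) (k m : nat) (rs : seq nat) : tab :=
  if rs is r :: rs' then qrec (add_box Q r (m - k + 1)) k.+1 m rs' else Q.

(** The recording tableau sees the insertion only through the rows of the new boxes, and these agree
    for a word and its standardization. *)
Lemma rs_aux_qrec f P Q k m w :
  pairwise (std_rel f) (rword P ++ w) -> all (sorted gtn) P ->
  (rs_aux P Q k m w).2 = qrec Q k m (ridx leq (map (map f) P) (map f w)).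
Proof.
elim: w P Q k => [|y w IH] P Q k //= pw sP.
have [e pw' sP' ->] := ins_std pw sP.
by case E: (ins ltn P y) e pw' sP' => [P' r] /= -> pw' sP'; rewrite /= IH.
Qed.

Lemma recording_std w : recording (std w) = qrec [::] 1 (size w) (ridx leq [::] w).
Proof.
by rewrite /recording (rs_aux_qrec (f := unstd w)) ?std_pairwise // map_unstd std_size.
Qed.

Lemma ridx_cat lt P w1 w2 :
  ridx lt P (w1 ++ w2) = ridx lt P w1 ++ ridx lt (insw lt P w1) w2.
Proof. by elim: w1 P => //= y w1 IH P; rewrite IH. Qed.

Lemma ins_row_le lt P y : (ins lt P y).2 <= size P.
Proof. by elim: P y => //= row P IH y; case: ifP => //= _; rewrite ltnS. Qed.

Lemma ins_shape lt P y :
  map size (ins lt P y).1 = incr_nth (map size P) (ins lt P y).2.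
Proof.
elim: P y => //= row P IH y; case: ifP => h /=; rewrite ?IH size_set_nth.
  by congr (_ :: _); lia.
by congr (_ :: _); have := find_size (lt^~ y) row; lia.
Qed.

Lemma ishape_rcons w y :
  ishape (rcons w y) = incr_nth (ishape w) (ins leq (insw leq [::] w) y).2.
Proof. by rewrite /ishape /insw foldl_rcons ins_shape. Qed.

Lemma size_ridx lt P w : size (ridx lt P w) = size w.
Proof. by elim: w P => //= y w IH P; rewrite IH. Qed.

Lemma map_add_box (g : nat -> nat) Q r v : r <= size Q ->
  map (map g) (add_box Q r v) = add_box (map (map g) Q) r (g v).
Proof.
rewrite /add_box; elim: Q r => [|row Q IH] [|r] //= h; first by rewrite map_rcons.
by rewrite -[in RHS]IH.
Qed.

Lemma size_add_box Q r v : r <= size Q -> map size (add_box Q r v) = incr_nth (map size Q) r.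
Proof.
rewrite /add_box; elim: Q r => [|row Q IH] [|r] //= h; first by rewrite size_rcons.
by rewrite -IH.
Qed.

Lemma qrec_rcons Q k m rs r :
  qrec Q k m (rcons rs r) = add_box (qrec Q k m rs) r (m - (k + size rs) + 1).
Proof. by elim: rs Q k => [|a rs IH] Q k /=; rewrite ?addn0 // IH addSnnS. Qed.

(** Since the k-th box gets m - k + 1, one more letter raises every old label by one and gives the
    new box the label 1. This is the effect on the bullets of lowering the threshold by one. *)
Lemma recording_rcons w y :
  let r := (ins leq (insw leq [::] w) y).2 in
  [/\ recording (std (rcons w y)) = add_box (map (map succn) (recording (std w))) r 1,
      map size (recording (std w)) = ishape w & r <= size (ishape w)].
Proof.
pose Pw := insw leq [::] w.
have key : forall w' P Q k m, map size Q = map size P -> size w' + k = m.+1 ->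
   map size (qrec Q k m (ridx leq P w')) = map size (insw leq P w') /\
   qrec (map (map succn) Q) k m.+1 (ridx leq P w') = map (map succn) (qrec Q k m (ridx leq P w')).
  elim=> [|z w' IH] P Q k m eQ ek //=.
  have sQ : (ins leq P z).2 <= size Q.
    by rewrite -(size_map size) eQ size_map ins_row_le.
  have [||h1 h2] := IH (ins leq P z).1 (add_box Q (ins leq P z).2 (m - k + 1)) k.+1 m.
  - by rewrite size_add_box // eQ ins_shape.
  - by move: ek => /=; lia.
  - split=> //; rewrite -h2 map_add_box //; congr (qrec (add_box _ _ _) _ _ _).
    by move: ek => /=; lia.
have [||k1 k2] := key w [::] [::] 1 (size w) => //; first by rewrite addn1.
rewrite !recording_std k1 size_rcons -cats1 ridx_cat; split=> //.
  by rewrite /= cats1 qrec_rcons size_ridx -k2 /= add1n subnn.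
by rewrite size_map ins_row_le.
Qed.

(** * The operators phi *)

(* [a] and [b] are two consecutive columns (top to bottom), [z] the column to
   the left of [a], [R] the chain of rows along which [phi] shifts column [a],
   and [a'] the shifted column. *)
Section ColumnShift.
#[local] Set Default Proof Using "All".
Variables (a b z a' R : nat -> nat) (k : nat).
Hypothesis row_ab : forall s, b s <= a s.
Hypothesis trip_ab : forall r s, r < s -> 0 < b s -> b s <= a r -> b s < b r.
Hypothesis trip_za : forall r s, r < s -> 0 < a s -> a s <= z r -> a s < a r.
Hypothesis a_inj : forall r s, 0 < a r -> a r = a s -> r = s.
Hypothesis R_next : forall p, p < k ->
  [/\ R p.+1 < R p, a (R p) < a (R p.+1), b (R p.+1) <= a (R p) &
      forall s, R p.+1 < s -> s < R p -> a (R p) < a s -> a (R p) < b s].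
Hypothesis R_last : forall s, s < R k -> a (R k) < a s -> a (R k) < b s.
Hypothesis R_first : [/\ 0 < a (R 0), b (R 0) = 0 &
  forall s, R 0 < s -> 0 < a s -> 0 < b s].
Hypothesis a'_first : a' (R 0) = 0.
Hypothesis a'_next : forall p, p < k -> a' (R p.+1) = a (R p).
Hypothesis a'_other : forall s, (forall p, p <= k -> s <> R p) -> a' s = a s.
Hypothesis R_dec : forall s, (exists2 p, p <= k & s = R p) \/ (forall p, p <= k -> s <> R p).

Lemma R_mono p q : p < q -> q <= k -> R q < R p /\ a (R p) < a (R q).
Proof.
elim: q => // q IH; rewrite ltnS leq_eqVlt => /orP[/eqP->|pq] qk.
  by case: (R_next qk).
have [h1 h2] := IH pq (ltnW qk); have [h3 h4 _ _] := R_next qk.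
by split; [apply: ltn_trans h1 | apply: ltn_trans h4].
Qed.

(** Induction along the chain. If b s <= a (R p.+1), the triple rule gives b s < b (R p.+1) <= a (R
    p). But a (R p) < b s, because [s] was either skipped between two links or lies below [R p]. At
    the start of the chain b is 0 while the rows below have positive b. *)
Lemma shift_pass p s : p <= k -> (forall q, q <= k -> s <> R q) ->
  R p < s -> a (R p) < a s -> a (R p) < b s.
Proof.
move=> + sR; elim: p => [|p IH] pk ps hs.
  have [h1 h2 h3] := R_first; rewrite ltnNge; apply/negP => hb.
  have := trip_ab ps (h3 _ ps (leq_ltn_trans (leq0n _) hs)) hb; rewrite h2; lia.
have [h1 h2 h3 h4] := R_next pk.
rewrite ltnNge; apply/negP => hb.
have b0 : 0 < b s.
  have [h5|h5|h5] := ltngtP s (R p); last by case: (sR p (ltnW pk)).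
    by have := h4 s ps h5 (ltn_trans h2 hs); lia.
  by have := IH (ltnW pk) h5 (ltn_trans h2 hs); lia.
have hb' := trip_ab ps b0 hb.
have [h5|h5|h5] := ltngtP s (R p); last by case: (sR p (ltnW pk)).
  by have := h4 s ps h5 (ltn_trans h2 hs); lia.
by have := IH (ltnW pk) h5 (ltn_trans h2 hs); lia.
Qed.

(** Consequently the columns a and b have the same number of entries above the exiting one. *)
Lemma shift_exit s : a (R k) < a s -> a (R k) < b s.
Proof.
move=> hs; case: (R_dec s) => [[p pk e]|sR].
  subst s; move: (pk); rewrite leq_eqVlt => /orP[/eqP pk'|pk']; first by move: hs; rewrite pk' ltnn.
  by have [_] := R_mono pk' (leqnn k); lia.
have [h|h|h] := ltngtP s (R k); [exact: R_last | exact: shift_pass | by case: (sR k)].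
Qed.

Lemma shift_le s : a' s <= a s.
Proof.
case: (R_dec s) => [[[|p] pk ->]|/a'_other ->//]; first by rewrite a'_first.
by rewrite a'_next //; case: (R_next pk) => _ /ltnW.
Qed.

Lemma shift_row s : b s <= a' s.
Proof.
case: (R_dec s) => [[[|p] pk ->]|/a'_other ->//]; first by case: R_first => _ ->.
by rewrite a'_next //; case: (R_next pk).
Qed.

Lemma shift_trip_right r s : r < s -> 0 < b s -> b s <= a' r -> b s < b r.
Proof. by move=> rs bs h; apply: trip_ab => //; apply: leq_trans (shift_le r). Qed.

(** The delicate case has [r] on the chain and [s] off it. If the lowered value a (R p) fell below a
    s, then a (R p) < b s by the choice of the chain, while the triple rule at columns a, b yields b
    s < b (R p.+1) <= a (R p). *)
Lemma shift_trip_left r s : r < s -> 0 < a' s -> a' s <= z r -> a' s < a' r.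
Proof.
move=> rs; case: (R_dec s) => [[[|q] qk e]|sR].
- by rewrite e a'_first.
- rewrite e a'_next // => h0 hz.
  have [h1 h2 _ _] := R_next qk.
  have rq : r < R q by apply: ltn_trans h1; rewrite -e.
  have har := trip_za rq h0 hz.
  case: (R_dec r) => [[p pk er]|/a'_other ->//].
  have qp : q.+1 < p.
    rewrite ltnNge leq_eqVlt; apply/negP => /orP[/eqP ep|pq].
      by move: rs; rewrite er e ep ltnn.
    by have [] := R_mono pq qk; move: rs; rewrite er e; lia.
  case: p pk er qp => // p pk er qp; rewrite er a'_next //.
  by have [] := R_mono (qp : q < p) (ltnW pk).
rewrite (a'_other sR) => h0 hz; have har := trip_za rs h0 hz.
case: (R_dec r) => [[[|p] pk er]|/a'_other ->//].
  have [h1 h2 h3] := R_first; move: rs har; rewrite er => rs har.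
  by have := trip_ab rs (h3 s rs h0) (leq_trans (row_ab s) (ltnW har)); lia.
rewrite er in rs har *; rewrite a'_next // ltnNge leq_eqVlt; apply/negP => /orP[/eqP ep|hs].
  by have [h _ _] := R_first; apply: (sR p (ltnW pk)); symmetry; apply: a_inj; lia.
have [h1 h2 h3 h4] := R_next pk.
have hb : a (R p) < b s.
  have [h5|h5|h5] := ltngtP s (R p); last by case: (sR p (ltnW pk)).
    exact: h4.
  by apply: shift_pass => //; apply: ltnW.
have := trip_ab rs (leq_ltn_trans (leq0n _) hb) (leq_trans (row_ab s) (ltnW har)); lia.
Qed.

(** This is the triple condition against the row that [mu] appends at the bottom, where the exiting
    entry stands one column further to the right. *)
Lemma shift_new_row s : a (R k) <= a' s -> a (R k) < b s.
Proof.
have [h0 _ _] := R_first.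
have hk : 0 < a (R k).
  by case: (posnP k) => [->//|k0]; have [_] := R_mono k0 (leqnn k); apply: leq_ltn_trans.
case: (R_dec s) => [[[|p] pk ->]|sR].
- by rewrite a'_first; lia.
- rewrite a'_next //; have [_] := R_mono pk (leqnn k); lia.
rewrite (a'_other sR) leq_eqVlt => /orP[/eqP e|]; last exact: shift_exit.
by case: (sR k) => //; symmetry; apply: a_inj.
Qed.

End ColumnShift.

Definition linkable (T : tab) (t r s : nat) : bool :=
  (entry T r t.-1 < entry T s t.-1) && (entry T s t <= entry T r t.-1).

Lemma leq_last_sorted s x : sorted ltn s -> x \in s -> x <= last 0 s.
Proof.
case/lastP: s => // s y; rewrite last_rcons mem_rcons inE (sorted_pairwise ltn_trans).
by rewrite pairwise_rcons => /andP[/allP h _] /orP[/eqP->//|/h /ltnW].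
Qed.

(** Row indices decrease along the chain, so [r <= f] is enough fuel. *)
Lemma chainP T t r f : r <= f ->
  let ch := chain T t r f in
  [/\ nth 0 ch 0 = r, 0 < size ch,
      forall p, p.+1 < size ch ->
        [/\ nth 0 ch p.+1 < nth 0 ch p, linkable T t (nth 0 ch p) (nth 0 ch p.+1) &
            forall s, nth 0 ch p.+1 < s -> s < nth 0 ch p -> ~~ linkable T t (nth 0 ch p) s] &
      forall s, s < nth 0 ch (size ch).-1 -> ~~ linkable T t (nth 0 ch (size ch).-1) s].
Proof.
elim: f r => [|f IH] r rf /=; first by split=> //; case: r rf.
set cands := [seq s <- iota 0 r | _].
have mc s : (s \in cands) = (s < r) && linkable T t r s.
  by rewrite mem_filter mem_iota add0n andbC.
have sc : sorted ltn cands by apply: sorted_filter (iota_ltn_sorted _ _); exact: ltn_trans.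
case E : cands => [|x0 c0].
  split=> //= s sr; apply/negP => h; have := mc s; rewrite E in_nil sr h //.
have lc : last 0 cands \in cands by rewrite E /= mem_last.
move: (lc); rewrite mc => /andP[lr hl]; rewrite -E.
have lf : last 0 cands <= f by rewrite -ltnS; apply: leq_trans lr rf.
have [h1 h2 h3 h4] := IH _ lf; split=> //=; last first.
  by move: h4 h2; case: (chain T t (last 0 cands) f).
case=> [|p] /= hp; last by apply: h3.
rewrite h1; split=> // s ls sr; apply/negP => hs.
have : s \in cands by rewrite mc sr.
by move/(leq_last_sorted sc); lia.
Qed.

(** * Column contents and the effect of a single phi *)

Definition col (T : tab) (c : nat) : seq nat :=
  [seq x <- [seq nth 0 row c | row <- T] | x != 0].

Definition nabove (T : tab) (k c : nat) : nat := count (fun row => k < nth 0 row c) T.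

Definition positive_rows (T : tab) : bool := all (fun row => (0 < size row) && (0 \notin row)) T.

(** SSRCT of straight shape with distinct entries. Distinctness replaces standardness, which is lost
    while entries are exiting, and is stated by columns because the operators are described by what
    enters and leaves each column. *)
Record good (T : tab) : Prop := Good {
  good_positive : positive_rows T;
  good_row : forall r c, entry T r c.+1 <= entry T r c;
  good_first : forall r s, r < s -> s < size T -> entry T r 0 < entry T s 0;
  good_trip : forall r s c, r < s -> 0 < entry T s c.+1 ->
    entry T s c.+1 <= entry T r c -> entry T s c.+1 < entry T r c.+1;
  good_uniq : forall c, uniq (col T c);
  good_disj : forall c c' x, x \in col T c -> x \in col T c' -> c = c' }.

Lemma nabove_col T k c : nabove T k c = count (ltn k) (col T c).
Proof.
rewrite /nabove /col count_filter count_map; apply: eq_count => row /=.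
by case: (nth 0 row c) => [|x]; rewrite ?andbF ?andbT.
Qed.

Lemma entry_default T r c : size T <= r -> entry T r c = 0.
Proof. by move=> h; rewrite /entry (nth_default [::]) // nth_nil. Qed.

Lemma entry_gt0 T r c : positive_rows T ->
  (0 < entry T r c) = (r < size T) && (c < size (nth [::] T r)).
Proof.
move=> pT; have [rT|rT] := ltnP r (size T); last by rewrite entry_default.
have [cr|cr] := ltnP c (size (nth [::] T r)); last by rewrite /entry nth_default.
have /andP[_ h] := allP pT _ (mem_nth [::] rT).
by rewrite lt0n; apply: contra h => /eqP <-; apply: mem_nth.
Qed.

Lemma map_nth_entry T c : [seq nth 0 row c | row <- T] = mkseq (entry T ^~ c) (size T).
Proof.
apply: (@eq_from_nth _ 0); rewrite ?size_map ?size_iota // => i iT.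
by rewrite (nth_map [::]) // nth_mkseq.
Qed.

Lemma mem_col T c x : reflect (exists2 r, x = entry T r c & 0 < x) (x \in col T c).
Proof.
rewrite mem_filter -lt0n map_nth_entry; apply: (iffP andP) => [[x0 /mapP[r _ e]]|[r e x0]].
  by exists r.
split=> //; apply/mapP; exists r => //; rewrite mem_iota add0n /=.
by rewrite ltnNge; apply/negP => /entry_default h; move: x0; rewrite e h.
Qed.

Lemma uniq_filter_map_inj (f : nat -> nat) s i j :
  uniq [seq x <- map f s | x != 0] -> i \in s -> j \in s -> f i != 0 -> f i = f j -> i = j.
Proof.
rewrite filter_map => u is_ js fi e.
have is' : i \in [seq x <- s | preim f (fun x => x != 0) x] by rewrite mem_filter /= fi.
have js' : j \in [seq x <- s | preim f (fun x => x != 0) x] by rewrite mem_filter /= -e fi.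
rewrite -(nth_index 0 is') -(nth_index 0 js'); congr (nth _ _ _).
move/uniqP: u => /(_ 0); apply; rewrite ?inE ?size_map ?index_mem //.
by rewrite !(nth_map 0) ?index_mem // !nth_index.
Qed.

Lemma entry_inj T c r s : good T ->
  0 < entry T r c -> entry T r c = entry T s c -> r = s.
Proof.
move=> gT h e; have := good_uniq gT c; rewrite /col map_nth_entry => u.
have inT x : 0 < entry T x c -> x \in iota 0 (size T).
  by rewrite mem_iota add0n /= (entry_gt0 _ _ (good_positive gT)) => /andP[].
apply: (uniq_filter_map_inj u) => //; [exact: inT | by apply: inT; rewrite -e | by rewrite -lt0n].
Qed.

Lemma last_index (t : nat) (sz : seq nat) : t \in sz ->
  let r := (size sz).-1 - index t (rev sz) in
  [/\ r < size sz, nth 0 sz r = t & forall s, r < s -> s < size sz -> nth 0 sz s <> t].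
Proof.
move=> tsz; have := tsz; rewrite -mem_rev => /[dup] /(nth_index 0).
rewrite -index_mem size_rev => + hi; rewrite nth_rev // => e.
have er : (size sz).-1 - index t (rev sz) = size sz - (index t (rev sz)).+1 by lia.
split=> /=; [|by rewrite er|move=> s hs ss es].
  by rewrite er; move: hi; case: (size sz) => // n _; rewrite subSS ltnS leq_subr.
have hj : size sz - s.+1 < index t (rev sz) by lia.
have /eqP[] := negbT (before_find 0 hj); rewrite nth_rev; last lia.
by rewrite (_ : size sz - (size sz - s.+1).+1 = s) //; lia.
Qed.

Lemma entry_set U r c v s c' :
  entry (set_entry U r c v) s c' = if (s == r) && (c' == c) then v else entry U s c'.
Proof.
rewrite /entry /set_entry nth_set_nth /=; case: eqP => [->|] //=.
by rewrite nth_set_nth /=.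
Qed.

Lemma size_set_entry U r c v : r < size U -> c < size (nth [::] U r) ->
  map size (set_entry U r c v) = map size U.
Proof.
move=> rU cU; apply: (@eq_from_nth _ 0).
  by rewrite !size_map size_set_nth; apply/maxn_idPr.
move=> i; rewrite size_map size_set_nth (maxn_idPr rU) => iU.
rewrite !(nth_map [::]) // ?size_set_nth ?(maxn_idPr rU) //.
by rewrite nth_set_nth /=; case: eqP => [->|//]; rewrite size_set_nth; apply/maxn_idPr.
Qed.

(** [v] is a snapshot of the original column, so the values written are not affected by earlier
    writes. *)
Definition shift_col (v : nat -> nat) (c : nat) (U : tab) (ch : seq nat) : tab :=
  foldl (fun U (pr : nat * nat) => set_entry U pr.1 c (v pr.2)) U (zip (behead ch) ch).

Lemma entry_shift v c U r ch s c' : path gtn r ch ->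
  entry (shift_col v c U (r :: ch)) s c' =
  if (c' == c) && (s \in ch) then v (nth 0 (r :: ch) (index s ch)) else entry U s c'.
Proof.
rewrite /shift_col /=; elim: ch r U => [|r2 ch IH] r U; first by rewrite andbF.
rewrite [path _ _ _]/= => /andP[_ pch] /=; rewrite IH // entry_set inE (eq_sym r2).
have := pch; rewrite (path_sortedE gtn_trans).
case: (eqVneq s r2) => [->|ne] /=.
  case/andP=> /allP h _; have -> : (r2 \in ch) = false.
    by apply/negP => /h /=; rewrite ltnn.
  by rewrite andbF andbT; case: eqP.
by move=> _; case: (c' == c).
Qed.

Lemma size_shift v c U r ch : all (fun s => (s < size U) && (c < size (nth [::] U s))) ch ->
  map size (shift_col v c U (r :: ch)) = map size U.
Proof.
rewrite /shift_col /=; elim: ch r U => [|r2 ch IH] r U //= /andP[/andP[h1 h2] h].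
have e := size_set_entry (v r) h1 h2.
have esz : size (set_entry U r2 c (v r)) = size U by rewrite -(size_map size) e size_map.
rewrite IH // (eq_all (a2 := fun s => (s < size U) && (c < size (nth [::] U s)))) // => s.
rewrite esz; case: ltnP => //= sU.
by rewrite -[in LHS](nth_map _ 0) ?esz // e (nth_map [::]).
Qed.

Lemma perm_set_nth (M : seq nat) r v : r < size M ->
  perm_eq (nth 0 M r :: set_nth 0 M r v) (v :: M).
Proof.
elim: M r => //= x M IH [|r] rM /=; first by apply/permP => q /=; rewrite addnCA.
have := IH r rM => /permP h; apply/permP => q; have := h q => /=; lia.
Qed.

Lemma map_set_entry U r c v : r < size U ->
  [seq nth 0 row c | row <- set_entry U r c v] = set_nth 0 [seq nth 0 row c | row <- U] r v.
Proof.
move=> rU; apply: (@eq_from_nth _ 0); rewrite ?size_set_nth !size_map !size_set_nth ?size_map //.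
move=> i; rewrite (maxn_idPr rU) => iU.
rewrite (nth_map [::]) ?size_set_nth ?(maxn_idPr rU) // !nth_set_nth /=.
case: eqP => [_|_]; first by rewrite nth_set_nth /= eqxx.
by rewrite (nth_map [::]).
Qed.

Lemma perm_shift v c U r ch : path gtn r ch ->
  all (fun s => s < size U) ch -> {in ch, forall s, v s = entry U s c} ->
  perm_eq (v (last r ch) :: [seq nth 0 row c | row <- shift_col v c U (r :: ch)])
          (v r :: [seq nth 0 row c | row <- U]).
Proof.
rewrite /shift_col /=; elim: ch r U => [|r2 ch IH] r U //=.
case/andP=> _ pch /andP[r2U hU] hv.
apply: perm_trans (_ : perm_eq (v r2 :: [seq nth 0 row c | row <- set_entry U r2 c (v r)]) _).
  have h : size (set_entry U r2 c (v r)) = size U by rewrite size_set_nth; apply/maxn_idPr.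
  apply: IH => //; first by rewrite h.
  move=> s sch; rewrite entry_set hv ?inE ?sch ?orbT //.
  move: pch; rewrite (path_sortedE gtn_trans) => /andP[/allP /(_ _ sch) /= sr _].
  by rewrite (ltn_eqF sr).
rewrite map_set_entry // hv ?mem_head // /entry -(nth_map _ 0 (fun row => nth 0 row c)) //.
by apply: perm_set_nth; rewrite size_map.
Qed.

Lemma set_nth_take_drop (A : Type) (x0 : A) s i y : i < size s ->
  set_nth x0 s i y = take i s ++ y :: drop i.+1 s.
Proof. by elim: s i => //= x s IH [|i] h /=; rewrite ?drop0 // IH. Qed.

(** [phi_drop] speaks of membership rather than row indices because a row may disappear. [phi_next]
    prepares the triple condition against the future last row, and [phi_above] is the balance used
    by the level words. *)
Record phi_spec (t : nat) (T T' : tab) (h : nat) : Prop := PhiSpec {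
  phi_good : good T';
  phi_shape : Some (map size T') = dop t (Some (map size T));
  phi_pos : 0 < h;
  phi_col : perm_eq (col T t.-1) (h :: col T' t.-1);
  phi_cols : forall c, c != t.-1 -> col T' c = col T c;
  phi_drop : forall row', row' \in T' -> exists2 row, row \in T & drop t row' = drop t row;
  phi_next : forall row, row \in T' -> h <= nth 0 row t.-1 -> h < nth 0 row t;
  phi_above : nabove T h t.-1 = nabove T h t }.

Lemma good_cols T T' (e : nat -> seq nat) :
  (forall c, uniq (col T c)) -> (forall c c' x, x \in col T c -> x \in col T c' -> c = c') ->
  (forall c, perm_eq (col T c) (e c ++ col T' c)) ->
  (forall c, uniq (col T' c)) /\
  (forall c c' x, x \in col T' c -> x \in col T' c' -> c = c').
Proof.
move=> u d p; split=> [c|c c' x xc xc'].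
  by have := u c; rewrite (perm_uniq (p c)) cat_uniq => /and3P[].
by apply: (d c c' x); rewrite (perm_mem (p _)) mem_cat ?xc ?xc' orbT.
Qed.

Lemma phi_cols_uniq t T T' h : good T ->
  perm_eq (col T t.-1) (h :: col T' t.-1) -> (forall c, c != t.-1 -> col T' c = col T c) ->
  (forall c, uniq (col T' c)) /\
  (forall c c' x, x \in col T' c -> x \in col T' c' -> c = c').
Proof.
move=> gT p q; apply: (@good_cols T T' (fun c => if c == t.-1 then [:: h] else [::])).
- exact: good_uniq.
- exact: good_disj.
by move=> c; case: eqP => [->|/eqP/q ->].
Qed.

Lemma nabove_entry T k c c' :
  (forall r, (k < entry T r c) = (k < entry T r c')) -> nabove T k c = nabove T k c'.
Proof.
move=> h; rewrite /nabove; apply: eq_in_count => row /(nthP [::])[r _ <-]; exact: h.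
Qed.

Lemma longer_below T t r1 s : good T -> 0 < t ->
  (forall s, r1 < s -> s < size T -> nth 0 (map size T) s <> t) ->
  r1 < s -> 0 < entry T s t.-1 -> 0 < entry T s t.
Proof.
move=> gT t0 hr rs; rewrite !entry_gt0 ?good_positive // => /andP[sT ts]; rewrite sT /=.
have := hr s rs sT; rewrite (nth_map [::]) //.
by case: t t0 ts {hr} => //= t _; rewrite leq_eqVlt => /orP[/eqP->|].
Qed.

(** Separate because the row [r1] vanishes: row r of the result is row [bump r1 r] of [T]. The first
    column increases downwards, so no row above [r1] can be linked and the chain is trivial. *)
Lemma phi1P T : good T -> 1 \in map size T -> phi_spec 1 T (phi 2 T).1 (phi 2 T).2.
Proof.
move=> gT h1; have [hr e1 hlast] := last_index h1.
rewrite !size_map in hr e1 hlast.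
rewrite /phi /=; set r1 := (size T).-1 - _; rewrite -/r1 in hr e1 hlast.
have -> : chain T 1 r1 (size T) = [:: r1].
  case: (size T) => [|f] //=; case E : [seq _ <- _ | _] => [|x s] //.
  have : x \in x :: s by rewrite mem_head.
  rewrite -E mem_filter mem_iota add0n /= => /andP[/andP[h _] xr].
  by have := good_first gT xr hr; rewrite ltnNge (ltnW h).
rewrite /=; set T' := _ ++ _; set h := entry T r1 0.
have srow : size (nth [::] T r1) = 1 by rewrite -(nth_map _ 0) // size_map.
have Tsplit : T = take r1 T ++ nth [::] T r1 :: drop r1.+1 T.
  by rewrite -drop_nth // cat_take_drop.
have eT' r c : entry T' r c = entry T (bump r1 r) c.
  rewrite /entry /T' nth_cat size_takel ?(ltnW hr) // /bump.
  case: (leqP r1 r) => rr; last by rewrite nth_take.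
  by rewrite nth_drop addSn subnKC.
have szT' : size T' = (size T).-1.
  by rewrite size_cat size_takel ?(ltnW hr) // size_drop; lia.
have bmono r s : r < s -> bump r1 r < bump r1 s by rewrite /bump; lia.
have hpos : 0 < h by rewrite entry_gt0 ?good_positive // hr srow.
have hb s : h < entry T s 0 -> h < entry T s 1.
  move=> hs; have rs : r1 < s.
    case: (ltngtP s r1) hs => // [sr|->]; last by rewrite ltnn.
    by have := good_first gT sr hr; rewrite -/h; lia.
  have b0 : 0 < entry T s 1.
    by apply: (longer_below (t := 1) gT _ hlast) => //=; lia.
  rewrite ltnNge; apply/negP => hle.
  have := good_trip gT rs b0 hle.
  by rewrite {2}/entry (nth_default 0 (s := nth [::] T r1)) ?srow.
have cS c : c != 0 -> col T' c = col T c.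
  move=> c0; rewrite [in RHS]Tsplit /col !map_cat /= !filter_cat /=.
  by rewrite (nth_default 0 (s := nth [::] T r1)) // srow lt0n.
have c0 : perm_eq (col T 0) (h :: col T' 0).
  rewrite [in X in perm_eq X _]Tsplit /col !map_cat /= !filter_cat /=.
  rewrite -[nth 0 (nth [::] T r1) 0]/h -lt0n hpos.
  by apply/permP => q; rewrite /= !count_cat /=; lia.
have [u d] := phi_cols_uniq (t := 1) gT c0 cS.
split=> //.
- split=> //.
  + apply/allP => row; rewrite mem_cat => /orP[/mem_take|/mem_drop] hrow; exact: (allP (good_positive gT) _ hrow).
  + by move=> r c; rewrite !eT' good_row.
  + by move=> r s rs sT; rewrite !eT'; apply: good_first; rewrite ?bmono //; move: sT; rewrite szT' /bump; lia.
  + by move=> r s c rs; rewrite !eT'; apply: good_trip => //; apply: bmono.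
- by rewrite /dop h1 size_map map_cat map_take map_drop.
- by move=> row' hrow; exists row' => //; move: hrow; rewrite mem_cat => /orP[/mem_take|/mem_drop].
- move=> row /(nthP [::])[r rT' <-]; rewrite -!/(entry T' r _) !eT' leq_eqVlt => /orP[/eqP e|].
    by have := entry_inj gT hpos e; rewrite /bump; lia.
  exact: hb.
apply: nabove_entry => r; apply/idP/idP => [/hb //|hh].
by apply: leq_trans hh (good_row gT _ _).
Qed.

(** Here row [r1] only loses its last box. [ColumnShift] is applied with a, b, z the 0-based columns
    t-1, t and t-2. *)
Lemma phi2P T t : good T -> 1 < t -> t \in map size T ->
  phi_spec t T (phi t.+1 T).1 (phi t.+1 T).2.
Proof.
move=> gT t1 ht; have [hr e1 hlast] := last_index ht.
rewrite !size_map in hr e1 hlast.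
rewrite /phi [t.+1.-1]/=; set r1 := (size T).-1 - _; rewrite -/r1 in hr e1 hlast.
have := chainP T t (ltnW hr); set ch := chain _ _ _ _; move=> [c1 c2 c3 c4].
have tt : t.-1 == 0 = false by lia.
have tS : t.-1.+1 = t by rewrite prednK // ltnW.
pose k := (size ch).-1; pose R p := nth 0 ch p.
pose a s := entry T s t.-1; pose b s := entry T s t; pose z s := entry T s t.-2.
have ek : k.+1 = size ch by rewrite prednK.
case Ech : ch c2 => [|r1' ch'] // _.
have er1 : r1' = r1 by rewrite -c1 Ech.
subst r1'.
have srow : size (nth [::] T r1) = t by rewrite -(nth_map _ 0) // size_map.
have row_ab s : b s <= a s by rewrite /a /b -{1}tS good_row.
have trip_ab r s : r < s -> 0 < b s -> b s <= a r -> b s < b r.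
  by rewrite /a /b -tS; apply: good_trip.
have trip_za r s : r < s -> 0 < a s -> a s <= z r -> a s < a r.
  by rewrite /a /z (_ : t.-1 = t.-2.+1); [apply: good_trip | lia].
have a_inj r s : 0 < a r -> a r = a s -> r = s by apply: entry_inj.
have R_next p : p < k -> [/\ R p.+1 < R p, a (R p) < a (R p.+1), b (R p.+1) <= a (R p) &
    forall s, R p.+1 < s -> s < R p -> a (R p) < a s -> a (R p) < b s].
  move=> pk; have [|h1 /andP[h2 h3] h4] := c3 p; first by rewrite -ek ltnS.
  split=> // s s1 s2 ha; have := h4 s s1 s2; rewrite /linkable -/(a _) -/(b _).
  by rewrite ha /= -ltnNge.
have R_last s : s < R k -> a (R k) < a s -> a (R k) < b s.
  move=> s1 ha; have := c4 s s1; rewrite /linkable -/(a _) -/(b _).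
  by rewrite ha /= -ltnNge.
have R0 : R 0 = r1 by rewrite /R c1.
have aR0 : 0 < a (R 0) by rewrite R0 entry_gt0 ?good_positive // hr srow; lia.
have bR0 : b (R 0) = 0 by rewrite R0 /b /entry nth_default // srow.
have R_first : [/\ 0 < a (R 0), b (R 0) = 0 & forall s, R 0 < s -> 0 < a s -> 0 < b s].
  split=> // s; rewrite R0 => rs as0; exact: (longer_below gT (ltnW t1) hlast rs as0).
have pch : path gtn r1 ch'.
  apply/(pathP 0) => i ich; have [|h _ _ _] := R_next i; first by rewrite -ltnS ek Ech.
  by move: h; rewrite /R Ech.
have R_dec s : (exists2 p, p <= k & s = R p) \/ (forall p, p <= k -> s <> R p).
  case: (boolP (s \in ch)) => [/(nthP 0)[p hp <-]|sn]; [left; exists p|right] => //.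
    by rewrite -ltnS ek.
  by move=> p pk e; case/negP: sn; rewrite e; apply: mem_nth; rewrite -ek.
pose T1 := shift_col a t.-1 T ch.
pose T' := set_nth [::] T1 r1 (take t.-1 (nth [::] T1 r1)).
pose a' s := entry T' s t.-1.
have ainr s : 0 < a s -> (s < size T) && (t.-1 < size (nth [::] T s)).
  by rewrite entry_gt0 ?good_positive.
have aRpos p : p <= k -> 0 < a (R p).
  case: p => // p pk; have [_ h _ _] := R_next p pk; lia.
have hall : all (fun s => (s < size T) && (t.-1 < size (nth [::] T s))) ch'.
  apply/(all_nthP 0) => i ich; apply: ainr.
  have -> : nth 0 ch' i = R i.+1 by rewrite /R Ech.
  by apply: aRpos; rewrite -ltnS ek Ech.
have szT1 : map size T1 = map size T by rewrite /T1 Ech size_shift.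
have sT1 : size T1 = size T by rewrite -(size_map size) szT1 size_map.
have srow1 : size (nth [::] T1 r1) = t by rewrite -(nth_map _ 0) ?sT1 // szT1.
have eT1 s c : entry T1 s c =
    if (c == t.-1) && (s \in ch') then a (nth 0 ch (index s ch')) else entry T s c.
  by rewrite /T1 Ech entry_shift.
have eT' s c : entry T' s c = if (s == r1) && (t.-1 <= c) then 0 else entry T1 s c.
  rewrite /T' /entry nth_set_nth /=; case: eqP => [->|] //=.
  case: leqP => h; last by rewrite nth_take.
  by rewrite nth_default // size_takel ?srow1; lia.
have r1ch : r1 \notin ch'.
  move: pch; rewrite (path_sortedE gtn_trans) => /andP[/allP h _].
  by apply/negP => /h /=; rewrite ltnn.
have eO s c : c != t.-1 -> entry T' s c = entry T s c.
  move=> ct; rewrite eT' eT1 (negPf ct) /=; case: ifP => // /andP[/eqP -> tc].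
  by rewrite /entry nth_default // srow; lia.
have a'0 : a' (R 0) = 0 by rewrite R0 /a' eT' eqxx leqnn.
have uch : uniq ch'.
  by apply: (sorted_uniq gtn_trans) (path_sorted pch) => x /=; rewrite ltnn.
have a'S p : p < k -> a' (R p.+1) = a (R p).
  move=> pk; have e : R p.+1 = nth 0 ch' p by rewrite /R Ech.
  have ps : p < size ch' by rewrite -ltnS -[(size ch').+1]/(size (r1 :: ch')) -Ech -ek.
  have inch : R p.+1 \in ch' by rewrite e mem_nth.
  rewrite /a' eT' eT1 eqxx inch e index_uniq // -e.
  by case: eqP => // er; move: inch r1ch; rewrite er => ->.
have a'N s : (forall p, p <= k -> s <> R p) -> a' s = a s.
  move=> sn; have sch : s \notin ch.
    apply/negP => /(nthP 0)[p hp e]; apply: (sn p); last by rewrite -e.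
    by rewrite -ltnS ek.
  move: sch; rewrite Ech inE negb_or => /andP[/negPf s1 /negPf s2].
  by rewrite /a' eT' eT1 s1 s2 andbF.
rewrite -Ech tt; change (phi_spec t T T' (entry T (last r1 ch) t.-1)).
have -> : entry T (last r1 ch) t.-1 = a (R k).
  by rewrite /R /k nth_last Ech.
have hk : 0 < a (R k) by apply: aRpos.
have hexit s : a (R k) < a s -> a (R k) < b s.
  exact: (shift_exit row_ab trip_ab trip_za a_inj R_next R_last R_first a'0 a'S a'N R_dec).
have hle s : a' s <= a s.
  exact: (shift_le row_ab trip_ab trip_za a_inj R_next R_last R_first a'0 a'S a'N R_dec).
have hrow s : b s <= a' s.
  exact: (shift_row row_ab trip_ab trip_za a_inj R_next R_last R_first a'0 a'S a'N R_dec).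
have hright r s : r < s -> 0 < b s -> b s <= a' r -> b s < b r.
  exact: (shift_trip_right row_ab trip_ab trip_za a_inj R_next R_last R_first a'0 a'S a'N R_dec).
have hleft r s : r < s -> 0 < a' s -> a' s <= z r -> a' s < a' r.
  exact: (shift_trip_left row_ab trip_ab trip_za a_inj R_next R_last R_first a'0 a'S a'N R_dec).
have hnew s : a (R k) <= a' s -> a (R k) < b s.
  exact: (shift_new_row row_ab trip_ab trip_za a_inj R_next R_last R_first a'0 a'S a'N R_dec).
have szT' : map size T' = set_nth 0 (map size T) r1 t.-1.
  apply: (@eq_from_nth _ 0); rewrite ?size_set_nth !size_map !size_set_nth ?size_map ?sT1 //.
  move=> i; rewrite (maxn_idPr hr) => iT.
  rewrite (nth_map [::]) ?size_set_nth ?sT1 ?(maxn_idPr hr) // !nth_set_nth /=.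
  case: eqP => _; first by rewrite size_takel ?srow1; lia.
  by rewrite -szT1 (nth_map [::]) ?sT1.
have sT' : size T' = size T by rewrite size_set_nth sT1; apply/maxn_idPr.
have colO c : c != t.-1 -> col T' c = col T c.
  by move=> ct; rewrite /col !map_nth_entry sT'; congr filter; apply: eq_map => s; apply: eO.
have colt : perm_eq (col T t.-1) (a (R k) :: col T' t.-1).
  have p1 : perm_eq (a (R k) :: [seq nth 0 row t.-1 | row <- T1])
      (a r1 :: [seq nth 0 row t.-1 | row <- T]).
    have -> : R k = last r1 ch' by rewrite /R /k nth_last Ech.
    rewrite /T1 Ech; apply: perm_shift => //; apply: sub_all hall => s; by case/andP.
  have p2 : perm_eq (a r1 :: [seq nth 0 row t.-1 | row <- T'])
      (0 :: [seq nth 0 row t.-1 | row <- T1]).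
    have -> : [seq nth 0 row t.-1 | row <- T'] = set_nth 0 [seq nth 0 row t.-1 | row <- T1] r1 0.
      apply: (@eq_from_nth _ 0); rewrite ?size_set_nth !size_map sT' ?sT1.
        by symmetry; apply/maxn_idPr.
      move=> i iT; rewrite (nth_map [::]) ?sT' // nth_set_nth /= -/(entry T' _ _) eT' leqnn andbT.
      by case: eqP => // _; rewrite (nth_map [::]) ?sT1.
    have -> : a r1 = nth 0 [seq nth 0 row t.-1 | row <- T1] r1.
      by rewrite (nth_map [::]) ?sT1 // -/(entry T1 _ _) eT1 (negPf r1ch) andbF.
    by apply: perm_set_nth; rewrite size_map sT1.
  apply/permP => q; rewrite /= /col !count_filter.
  move/permP/(_ (predI q (fun x => x != 0))): p1; move/permP/(_ (predI q (fun x => x != 0))): p2.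
  by rewrite /= -!lt0n hk andbF andbT; lia.
have [u d] := phi_cols_uniq gT colt colO.
split=> //.
- split=> //.
  + apply/allP => row /(nthP [::])[i iT <-]; apply/andP; split.
      have := congr1 (nth 0 ^~ i) szT'; rewrite (nth_map [::]) // => ->.
      rewrite nth_set_nth /=; case: eqP => _; first lia.
      have iT0 : i < size T by rewrite -sT'.
      by rewrite (nth_map [::]) //; have /andP[] := allP (good_positive gT) _ (mem_nth [::] iT0).
    have -> : nth [::] T' i = mkseq (entry T' i) (size (nth [::] T' i)).
      by rewrite /entry mkseq_nth.
    apply/negP => /mapP[c]; rewrite mem_iota add0n /= => ci e.
    have cT : c < size (nth [::] T i) /\ (i = r1 -> c < t.-1).
      have := congr1 (nth 0 ^~ i) szT'; rewrite (nth_map [::]) // nth_set_nth /=.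
      move: ci; case: eqP => [->|ne] ci es; first by split; [rewrite srow|]; lia.
      by split=> //; move: ci; rewrite es (nth_map [::]) // -sT'.
    have hc : 0 < entry T i c by rewrite entry_gt0 ?good_positive // -sT' iT; case: cT.
    have [ct|ct] := eqVneq c t.-1; last by move: e hc; rewrite eO // => <-.
    subst c; have : 0 < a' i; last by rewrite /a' -e.
    case: (R_dec i) => [[[|p] pk ei]|/a'N -> //].
      by move: cT => [_]; rewrite ei R0 => /(_ erefl); rewrite ltnn.
    by rewrite ei a'S //; apply: aRpos; apply: ltnW.
  + move=> r c; have [ct|ct] := eqVneq c t.-1.
      by subst c; rewrite tS (eO _ t) ?hrow //; lia.
    have [ct'|ct'] := eqVneq c.+1 t.-1; last by rewrite !eO ?good_row.
    rewrite ct' (eO _ c) //; apply: leq_trans (hle r) _.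
    by rewrite /a -ct' good_row.
  + by move=> r s rs sT; rewrite !eO ?good_first //; [rewrite -sT' | lia | lia].
  + move=> r s c rs; have [ct|ct] := eqVneq c t.-1.
      by subst c; rewrite tS !(eO _ t); [apply: hright | lia | lia].
    have [ct'|ct'] := eqVneq c.+1 t.-1; last by rewrite !eO //; apply: good_trip.
    rewrite ct' (eO _ c) //; have -> : c = t.-2 by lia.
    exact: hleft.
- rewrite /dop ht size_map tt szT' set_nth_take_drop ?size_map //.
- move=> row' /(nthP [::])[i iT' <-]; exists (nth [::] T i).
    by rewrite mem_nth // -sT'.
  apply: (@eq_from_nth _ 0).
    rewrite !size_drop; have := congr1 (nth 0 ^~ i) szT'; rewrite (nth_map [::]) // nth_set_nth /=.
    case: eqP => [->|ne] ->; first by rewrite srow; lia.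
    by rewrite (nth_map [::]) // -sT'.
  by move=> c _; rewrite !nth_drop; apply: eO; lia.
- move=> row /(nthP [::])[r rT' <-] h; rewrite -/(entry T' r t) eO; last lia.
  exact: hnew.
apply: nabove_entry => r; apply/idP/idP => [/hexit //|hh].
by apply: leq_trans hh (row_ab _).
Qed.

Lemma phiP T t : good T -> 0 < t -> t \in map size T ->
  phi_spec t T (phi t.+1 T).1 (phi t.+1 T).2.
Proof. by case: t => [//|[|t]] gT _; [apply: phi1P | apply: phi2P]. Qed.

(** * The slides mu *)

(* [H] lists the exiting entries, the one leaving column [k.-1] first, so that
   [nth 0 (rev H) c] leaves column [c]. *)
Record phis_spec (k : nat) (T T' : tab) (H : seq nat) : Prop := PhisSpec {
  phis_good : good T';
  phis_size : size H = k;
  phis_shape : Some (map size T') = vops k (Some (map size T));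
  phis_sorted : sorted ltn (0 :: H);
  phis_col : forall c, perm_eq (col T c)
    ([seq x <- [:: nth 0 (rev H) c] | x != 0] ++ col T' c);
  phis_drop : forall row', row' \in T' -> exists2 row, row \in T & drop k row' = drop k row;
  phis_next : forall c row, c < k -> row \in T' -> nth 0 (rev H) c <= nth 0 row c ->
    nth 0 (rev H) c < nth 0 row c.+1;
  phis_above : forall c, c < k ->
    nabove T (nth 0 (rev H) c) c = nabove T (nth 0 (rev H) c) c.+1 }.

Lemma nth_drop_eq (s s' : seq nat) k c : k <= c -> drop k s = drop k s' -> nth 0 s c = nth 0 s' c.
Proof. by move=> /subnKC <- e; rewrite -!nth_drop e. Qed.

Lemma dop_mem k al al' : 0 < k -> dop k.+1 (Some al) = Some al' -> k \in al'.
Proof.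
rewrite /dop; case: ifP => // _; case: k => // k _ [<-].
by rewrite mem_cat /= inE eqxx orbT.
Qed.

Lemma sub_in_count (A : eqType) (a b : pred A) s :
  {in s, forall x, a x -> b x} -> count a s <= count b s.
Proof.
move=> h; rewrite -(@eq_in_count _ (predI a b) a) => [|x /h /=]; last by case: (a x) => // ->.
by rewrite -count_filter; apply: leq_trans (count_size _ _) _; rewrite size_filter.
Qed.

Lemma nabove_row_le T k c : good T -> nabove T k c.+1 <= nabove T k c.
Proof.
move=> gT; apply: sub_in_count => row /(nthP [::])[r _ <-] h.
exact: leq_trans h (good_row gT r c).
Qed.

Lemma phisS k T : phis k.+1 T =
  ((phis k (phi k.+2 T).1).1, (phi k.+2 T).2 :: (phis k (phi k.+2 T).1).2).
Proof. by rewrite {1}/phis -/phis; case: (phi _ _) => T1 h; case: (phis _ _). Qed.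

Lemma phisP k T : good T -> (k == 0) || (k \in map size T) ->
  phis_spec k T (phis k T).1 (phis k T).2.
Proof.
elim: k T => [|k IH] T gT hk.
  split=> //; first by move=> c; rewrite nth_nil.
  by move=> row; exists row.
rewrite phisS; have := phiP gT (ltn0Sn k) hk.
case: (phi k.+2 T) => T1 h; rewrite [(_, _).1]/= [(_, _).2]/= => P.
have hk1 : (k == 0) || (k \in map size T1).
  (* The part k+1 just shortened supplies the part k required by the next operator. *)
  case: posnP => //= k0; apply: dop_mem k0 _; symmetry; exact: phi_shape P.
have := IH T1 (phi_good P) hk1; case: (phis k T1) => T2 H; rewrite [(_, _).1]/= [(_, _).2]/= => Q.
have nthG c : nth 0 (rev (h :: H)) c = if c == k then h else nth 0 (rev H) c.
  rewrite rev_cons nth_rcons size_rev (phis_size Q).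
  by case: ltngtP => // kc; rewrite nth_default // size_rev (phis_size Q) ltnW.
have cT1 c : c != k -> col T1 c = col T c by apply: phi_cols P _.
have hcol : h \in col T k by rewrite (perm_mem (phi_col P)) mem_head.
have abT1 x : nabove T x k = (x < h) + nabove T1 x k.
  by rewrite !nabove_col (permP (phi_col P)).
have h0 := phi_pos P.
(* If the entry g leaving column k-1 were below h, then before [h] left, column k would have had one
   more entry above g than column k-1, against the weak decrease of rows. *)
have ltG : 0 < k -> h < nth 0 (rev H) k.-1.
  move=> k0; have kk : k.-1 < k by rewrite prednK.
  have kne : k.-1 != k by rewrite neq_ltn kk.
  set g := nth 0 _ _; have g0 : g != 0.
    have : g \in H by rewrite -mem_rev mem_nth // size_rev (phis_size Q).
    have := phis_sorted Q; rewrite /= (path_sortedE ltn_trans) -lt0n => /andP[/allP hH _].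
    exact: hH.
  have gcol : g \in col T k.-1.
    by rewrite -cT1 // (perm_mem (phis_col Q _)) -/g /= g0 mem_head.
  have := phis_above Q kk; rewrite -/g prednK // => e.
  rewrite ltnNge leq_eqVlt; apply/negP => /orP[/eqP egh|gh].
    by have := good_disj gT hcol; rewrite -egh => /(_ _ gcol); lia.
  have := nabove_row_le g k.-1 gT; rewrite prednK // abT1 gh -e.
  by rewrite !nabove_col cT1 //; lia.
split.
- exact: phis_good Q.
- by rewrite /= (phis_size Q).
- by rewrite (phis_shape Q) (phi_shape P).
- move: ltG (phis_sorted Q) (phis_size Q); case: (H) => [|x s] /=; first by rewrite h0.
  move=> + /andP[_ hs] e; rewrite -e rev_cons nth_rcons size_rev ltnn eqxx => /(_ isT) ->.
  by rewrite h0.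
- move=> c; rewrite nthG; have [->|ck] := eqVneq c k; last first.
    by rewrite -cT1 //; apply: phis_col Q _.
  rewrite /= -lt0n h0 /=; apply: perm_trans (phi_col P) _; rewrite perm_cons /=.
  have := phis_col Q k; rewrite nth_default //.
  by rewrite size_rev (phis_size Q).
- move=> row2 /(phis_drop Q)[row1 /(phi_drop P)[row r e1] e2]; exists row => //.
  by rewrite -e1 -!(drop_drop _ 1 k) e2.
- move=> c row2; rewrite ltnS leq_eqVlt nthG => /orP[/eqP->|ck].
    rewrite eqxx => /(phis_drop Q)[row1 r1 e2].
    by rewrite (nth_drop_eq (leqnn k) e2) (nth_drop_eq (leqnSn k) e2); apply: phi_next P _ r1.
  by rewrite (ltn_eqF ck); apply: phis_next Q _ _ ck.
- move=> c; rewrite ltnS leq_eqVlt nthG => /orP[/eqP->|ck].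
  by rewrite eqxx; apply: phi_above P.
(* The removal of [h] could only disturb the count in column k, and there h < g is not counted. *)
rewrite (ltn_eqF ck); have := phis_above Q ck; set g := nth _ _ _.
rewrite (nabove_col T1 g c) cT1 ?ltn_eqF // -nabove_col => ->.
move: ck; rewrite leq_eqVlt => /orP[/eqP ck|ck]; last by rewrite !nabove_col cT1 ?ltn_eqF.
have := ltG (leq_ltn_trans (leq0n c) (eq_leq ck)).
by rewrite -ck /= -/g ck abT1 => /ltnW; rewrite leqNgt => /negPf ->.
Qed.

Lemma foldr_maxn_le (s : seq nat) x : x \in s -> x <= foldr maxn 0 s.
Proof.
elim: s => //= y s IH; rewrite inE => /orP[/eqP->|/IH h]; first exact: leq_maxl.
by apply: leq_trans h (leq_maxr _ _).
Qed.

Lemma mem_le_maxT T x : x \in flatten T -> x <= maxT T.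
Proof. exact: foldr_maxn_le. Qed.

Lemma col_flatten T c x : x \in col T c -> x \in flatten T.
Proof.
case/mem_col => r -> h.
have [rT|/entry_default e] := ltnP r (size T); last by move: h; rewrite e.
apply/flattenP; exists (nth [::] T r); first exact: mem_nth.
apply: mem_nth; rewrite ltnNge; apply/negP => h'.
by move: h; rewrite /entry nth_default.
Qed.

Definition mu_row (i : nat) (T : tab) : seq nat := (maxT T).+1 :: rev (phis i.-1 T).2.

(** In [mu_col], entry c+1 of the new row is the one that left column c. Past the end of the row the
    default 0 is filtered out, so the formula also covers the columns that do not change. *)
Record mu_spec (i : nat) (T : tab) : Prop := MuSpec {
  mu_eq : mu i T = rcons (phis i.-1 T).1 (mu_row i T);
  mu_good : good (mu i T);
  mu_shape : Some (map size (mu i T)) = uop i (Some (map size T));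
  mu_row_sorted : sorted gtn (rcons (mu_row i T) 0);
  mu_row_size : size (mu_row i T) = i;
  mu_col : forall c, perm_eq
    ([seq x <- [:: nth 0 (mu_row i T) c.+1] | x != 0] ++ col (mu i T) c)
    ([seq x <- [:: nth 0 (mu_row i T) c] | x != 0] ++ col T c);
  mu_above : forall c, c.+1 < i ->
    nabove T (nth 0 (mu_row i T) c.+1) c = nabove T (nth 0 (mu_row i T) c.+1) c.+1 }.

Lemma muP i T : good T -> 0 < i -> (i.-1 == 0) || (i.-1 \in map size T) -> mu_spec i T.
Proof.
move=> gT i0 hi; have P := phisP gT hi.
set G := mu_row i T.
have sG : sorted gtn (rcons G 0).
  have hr : sorted gtn (rcons (rev (phis i.-1 T).2) 0).
    by rewrite -rev_cons rev_sorted; apply: phis_sorted P.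
  rewrite /G /mu_row rcons_cons /=; case E : (rev (phis i.-1 T).2) hr => [|x s] //= ->.
  rewrite andbT ltnS; apply/mem_le_maxT/(@col_flatten _ 0).
  rewrite (perm_mem (phis_col P 0)) E mem_cat /= ifT ?mem_head //.
  have := phis_sorted P; rewrite -rev_sorted rev_cons E /=.
  rewrite (path_sortedE gtn_trans) => /andP[/allP h _].
  by rewrite -lt0n; apply: (h 0); rewrite mem_rcons mem_head.
(* The exiting entries increase in order of exit, so sorting them decreasingly is reversing them. *)
have eG : mu i T = rcons (phis i.-1 T).1 G.
  rewrite /mu /G /mu_row; case: (phis i.-1 T) P => T' H P /=; congr (rcons _ (_ :: _)).
  apply: (@sorted_eq _ geq); first by move=> a b c /= ab bc; apply: leq_trans bc ab.
  - by move=> a b /andP[/= ab ba]; apply/anti_leq/andP.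
  - by apply: sort_sorted => a b /=; apply: leq_total.
  - rewrite rev_sorted; have := phis_sorted P => /= /path_sorted.
    by apply: sub_sorted => a b /ltnW.
  - by rewrite perm_sort perm_sym perm_rev.
have szG : size G = i by rewrite /= size_rev (phis_size P) prednK.
have G0 c : (0 < nth 0 G c) = (c < i).
  have [ci|ci] := ltnP c i; last by rewrite nth_default ?szG.
  move: sG; rewrite (sorted_pairwise gtn_trans) pairwise_rcons => /andP[/allP h _].
  by apply: h; rewrite mem_nth ?szG.
have colG c : col (mu i T) c = col (phis i.-1 T).1 c ++ [seq x <- [:: nth 0 G c] | x != 0].
  by rewrite eG /col map_rcons filter_rcons /=; case: ifP; rewrite ?cats0 ?cats1.
have uG : uniq G.
  apply: (sorted_uniq gtn_trans) => [x /=|]; first by rewrite ltnn.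
  move: sG; rewrite !(sorted_pairwise gtn_trans) pairwise_rcons; by case/andP.
have T'T c x : x \in col (phis i.-1 T).1 c -> x \in col T c.
  by rewrite (perm_mem (phis_col P c)) mem_cat => ->; rewrite orbT.
have Gpred c : 0 < nth 0 G c.+1 -> nth 0 G c.+1 \in col T c.
  by rewrite (perm_mem (phis_col P c)) lt0n /= => ->; rewrite mem_head.
have Gnot c : 0 < nth 0 G c.+1 -> nth 0 G c.+1 \notin col (phis i.-1 T).1 c.
  have := good_uniq gT c; rewrite (perm_uniq (phis_col P c)) lt0n /= => + h.
  by rewrite h /= => /andP[].
have G0not c : nth 0 G 0 \notin col T c.
  by apply/negP => /col_flatten/mem_le_maxT; rewrite /= ltnn.
have origin c c' : 0 < nth 0 G c -> nth 0 G c \notin col (phis i.-1 T).1 c'.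
  case: c => [|c] h; first by apply: contra (G0not c') => /T'T.
  apply/negP => h'; have e := good_disj gT (Gpred c h) (T'T _ _ h').
  by have := Gnot c h; rewrite [X in col _ X]e h'.
have gT' := phis_good P.
split=> //.
- have eE r c : entry (mu i T) r c = if r < size (phis i.-1 T).1 then entry (phis i.-1 T).1 r c
      else if r == size (phis i.-1 T).1 then nth 0 G c else 0.
    rewrite eG /entry nth_rcons; case: ltngtP => // _; exact: nth_nil.
  split.
  + rewrite /positive_rows eG all_rcons -/(positive_rows _) (good_positive gT') andbT /=.
    move: sG; rewrite (sorted_pairwise gtn_trans) pairwise_rcons => /andP[/allP h _].
    by apply/negP => h0; have := h _ h0; rewrite /= ltnn.
  + move=> r c; rewrite !eE; have [rT|rT|rT] := ltngtP r (size (phis i.-1 T).1) => //; first exact: good_row.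
    have [ci|ci] := ltnP c.+1 i; last by rewrite nth_default ?szG.
    move: sG => /(sortedP 0) => /(_ c); rewrite size_rcons szG => /(_ (ltnW ci)).
    by rewrite !nth_rcons szG ci (ltnW ci) => h; apply: ltnW h.
  + move=> r s rs; rewrite eG size_rcons ltnS -eG !eE => sT.
    rewrite (leq_trans rs sT); move: sT; rewrite leq_eqVlt => /orP[/eqP es|sT]; last first.
      by rewrite sT; apply: good_first.
    rewrite es ltnn eqxx.
    have rT : r < size (phis i.-1 T).1 by rewrite -es.
    rewrite ltnS; apply/mem_le_maxT/(@col_flatten _ 0)/T'T/mem_col; exists r => //.
    rewrite entry_gt0 ?good_positive // rT /=.
    by have /andP[] := allP (good_positive gT') _ (mem_nth [::] rT).
  + move=> r s c rs; rewrite !eE; have [sT|sT|es] := ltngtP s (size (phis i.-1 T).1) => //.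
      by rewrite (ltn_trans rs sT); apply: good_trip.
    have rT : r < size (phis i.-1 T).1 by rewrite -es.
    rewrite rT G0 => ci; apply: (phis_next P); [lia | exact: mem_nth].
  + move=> c; rewrite colG cat_uniq (good_uniq gT') /= ; case: ifP => //=.
    by rewrite -lt0n orbF andbT; apply: origin.
  + move=> c c' x; rewrite !colG !mem_cat.
    have Gx d : x \in [seq y <- [:: nth 0 G d] | y != 0] -> 0 < nth 0 G d /\ x = nth 0 G d.
      by rewrite mem_filter inE -lt0n => /andP[h /eqP <-].
    case/orP=> [h1|/Gx[p1 e1]] /orP[h2|/Gx[p2 e2]].
    * exact (good_disj gT' h1 h2).
    * by move: h1; rewrite e2 (negPf (origin _ _ p2)).
    * by move: h2; rewrite e1 (negPf (origin _ _ p1)).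
    * by move/(uniqP 0): uG; apply; rewrite ?inE ?szG -?G0 // -e1 -e2.
- rewrite eG map_rcons szG; have := phis_shape P; rewrite /uop /aop.
  by move=> <-.
- move=> c; rewrite colG.
  apply/permP => q; rewrite !count_cat (permP (phis_col P c)) count_cat.
  have -> : nth 0 G c.+1 = nth 0 (rev (phis i.-1 T).2) c by [].
  by rewrite -/G addnA addnC.
by move=> c ci; apply: (phis_above P); lia.
Qed.

(** * From columns to the multiset of all entries *)

Lemma count_flatten_col (T : tab) x W : 0 < x -> {in T, forall row, size row <= W} ->
  count_mem x (flatten T) = \sum_(c < W) count_mem x (col T c).
Proof.
move=> x0; have cntW : forall s : seq nat, size s <= W ->
    count_mem x s = \sum_(c < W) (nth 0 s c == x).
  elim: W => [|W IH] s; first by case: s => //; rewrite big_ord0.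
  case: s => [_|y s hs] /=.
    by rewrite big1 // => c _; rewrite nth_nil; apply/eqP; rewrite eqb0; lia.
  by rewrite big_ord_recl /= -IH.
elim: T => [|row T IH] hW; first by rewrite big1.
rewrite /= count_cat IH => [|r rT]; last by apply: hW; rewrite inE rT orbT.
rewrite cntW ?hW ?mem_head // -big_split; apply: eq_bigr => c _ /=.
rewrite /col /=; case: (eqVneq (nth 0 row c) 0) => [->|ne] //=.
by rewrite (ltn_eqF x0).
Qed.

Lemma size_row_bound (T : tab) : exists W, {in T, forall row, size row <= W}.
Proof.
elim: T => [|row T [W hW]]; first by exists 0.
exists (maxn (size row) W) => r; rewrite inE => /orP[/eqP->|/hW h]; first exact: leq_maxl.
by apply: leq_trans h (leq_maxr _ _).
Qed.

Lemma count_zero_flatten T : positive_rows T -> count_mem 0 (flatten T) = 0.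
Proof.
move=> pT; apply/eqP; rewrite -leqn0 leqNgt -has_count has_pred1.
by apply/negP => /flattenP[row rT h']; have /andP[_ /negP] := allP pT _ rT; apply.
Qed.

Lemma uniq_flatten_good T : uniq (flatten T) ->
  (forall c, uniq (col T c)) /\
  (forall c c' x, x \in col T c -> x \in col T c' -> c = c').
Proof.
move=> u; have [W hW] := size_row_bound T.
have W_col c x : x \in col T c -> c < W.
  case/mem_col => r e x0; have [rT|/entry_default h] := ltnP r (size T); last first.
    by move: x0; rewrite e h.
  apply: leq_trans (hW _ (mem_nth [::] rT)); rewrite ltnNge; apply/negP => h.
  by move: x0; rewrite e /entry nth_default.
have cnt x : 0 < x -> \sum_(c < W) count_mem x (col T c) <= 1.
  by move=> x0; rewrite -count_flatten_col // count_uniq_mem // leq_b1.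
have pos c x : x \in col T c -> 0 < x by case/mem_col.
split=> [c|c c' x h h'].
  apply/count_mem_uniq => x; case: (boolP (x \in _)) => [h|/count_memPn //].
  apply/eqP; rewrite eqn_leq -has_count has_pred1 h andbT.
  apply: leq_trans (cnt x (pos c x h)).
  by rewrite (bigD1 (Ordinal (W_col c x h))) //= leq_addr.
apply/eqP; case: eqP => // ne; have := cnt x (pos c x h).
rewrite (bigD1 (Ordinal (W_col c x h))) //= (bigD1 (Ordinal (W_col c' x h'))) /=; last first.
  by apply/eqP => -[] e; apply: ne.
have : 0 < count_mem x (col T c) by rewrite -has_count has_pred1.
have : 0 < count_mem x (col T c') by rewrite -has_count has_pred1.
by move: (count _ (col T c)) (count _ (col T c')) (\sum_(i < W | _) _) => a b d; lia.
Qed.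

(** Summed over the columns, [mu_col] telescopes along the new row, and only its first entry
    [(maxT T).+1] is left over. *)
Lemma mu_flatten i T : good T -> mu_spec i T ->
  perm_eq (flatten (mu i T)) ((maxT T).+1 :: flatten T).
Proof.
move=> gT P; apply/permP => q.
suff h x : count_mem x (flatten (mu i T)) = count_mem x ((maxT T).+1 :: flatten T).
  by apply/permP: q; apply/allP => x _; apply/eqP/h.
have [->|x0] := posnP x.
  by rewrite /= !count_zero_flatten //; [exact: good_positive | exact: good_positive (mu_good P)].
have [W hW] := size_row_bound T; have [W' hW'] := size_row_bound (mu i T).
pose V := W + W' + i.
rewrite /= !(@count_flatten_col _ x V) //; first last.
- by move=> r /hW' h; apply: leq_trans h _; rewrite /V; lia.
- by move=> r /hW h; apply: leq_trans h _; rewrite /V; lia.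
set G := mu_row i T.
have e c : (nth 0 G c.+1 == x) + count_mem x (col (mu i T) c) =
           (nth 0 G c == x) + count_mem x (col T c).
  have := mu_col P c; rewrite -/G => /permP/(_ (pred1 x)); rewrite !count_cat.
  have f z : count_mem x [seq y <- [:: z] | y != 0] = (z == x).
    by case: (eqVneq z 0) => [->|ne] /=; rewrite ?(ltn_eqF x0) ?ne //= addn0.
  by rewrite !f.
have e1 : \sum_(c < V) (nth 0 G c.+1 == x) + \sum_(c < V) count_mem x (col (mu i T) c) =
          \sum_(c < V) (nth 0 G c == x) + \sum_(c < V) count_mem x (col T c).
  by rewrite -!big_split; apply: eq_bigr => c _; apply: e.
have e2 : (nth 0 G 0 == x) + \sum_(c < V) (nth 0 G c.+1 == x) = \sum_(c < V) (nth 0 G c == x).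
  have -> : \sum_(c < V) (nth 0 G c == x) = \sum_(c < V.+1) (nth 0 G c == x).
    by rewrite big_ord_recr /= (nth_default 0 (s := G)) ?(ltn_eqF x0) ?addn0 // (mu_row_size P) /V leq_addl.
  by rewrite big_ord_recl.
by move: e1 e2; rewrite [nth 0 G 0]/=; lia.
Qed.

(* 1-based index of the column in which the part of the tableau with entries
   greater than [k] grows under [mu i]. *)
Definition level (k i : nat) (T : tab) : nat := count (ltn k) (mu_row i T).

Fixpoint level_word (k : nat) (T : tab) (js : seq nat) : seq nat :=
  if js is j :: js' then level k j T :: level_word k (mu j T) js' else [::].

Fixpoint valid (T : tab) (js : seq nat) : bool :=
  if js is j :: js' then
    [&& 0 < j, (j.-1 == 0) || (j.-1 \in map size T) & valid (mu j T) js']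
  else true.

(** * Growth of the parts above a threshold *)

Lemma geq_trans : transitive geq.
Proof. by move=> y x z /= xy yz; apply: leq_trans yz xy. Qed.

Lemma nth_sorted_geq_count (s : seq nat) k c : sorted geq s ->
  (k < nth 0 s c) = (c < count (ltn k) s).
Proof.
elim: s c => [|x s IH] c /=; first by rewrite nth_nil.
rewrite (path_sortedE geq_trans) => /andP[/allP hx ss].
have h : x <= k -> count (ltn k) s = 0.
  move=> xk; apply/eqP; rewrite -leqn0 leqNgt -has_count; apply/hasP => -[y /hx /=]; lia.
case: c => [|c] /=; last by rewrite IH //; case: (ltnP k x) h => // _ ->.
by case: (ltnP k x) h => // _ ->.
Qed.

Lemma mu_row_decreasing i T : mu_spec i T -> sorted gtn (mu_row i T).
Proof.
move/mu_row_sorted; rewrite !(sorted_pairwise gtn_trans) pairwise_rcons.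
by case/andP.
Qed.

Lemma nth_mu_row k c i T : mu_spec i T -> (k < nth 0 (mu_row i T) c) = (c < level k i T).
Proof.
move=> P; apply: nth_sorted_geq_count.
by apply: sub_sorted (mu_row_decreasing P) => a b /ltnW.
Qed.

(** Column c gains entry c of the new row and loses entry c+1. These exceed [k] for c < level and
    c+1 < level respectively, so they cancel except where c+1 is the level. *)
Lemma nabove_mu k i T c : mu_spec i T ->
  nabove (mu i T) k c = nabove T k c + (c.+1 == level k i T).
Proof.
move=> P; have := mu_col P c => /permP/(_ (ltn k)); rewrite !count_cat -!nabove_col.
have f z : count (ltn k) [seq y <- [:: z] | y != 0] = (k < z).
  by case: z => //= z; rewrite addn0.
rewrite !f !nth_mu_row //; lia.
Qed.

Lemma level_gt0 k i T : k <= maxT T -> 0 < level k i T.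
Proof. by move=> h; rewrite /level /= ltnS h. Qed.

Lemma level_size i T : mu_spec i T -> level 0 i T = i.
Proof.
move=> P; rewrite -[RHS](mu_row_size P); apply/eqP; rewrite -all_count.
move: (mu_row_sorted P); rewrite (sorted_pairwise gtn_trans) pairwise_rcons => /andP[h _].
by apply: sub_all h => x.
Qed.

Lemma maxT_mu i T : good T -> mu_spec i T -> maxT (mu i T) = (maxT T).+1.
Proof.
move=> gT P; have e := perm_mem (mu_flatten gT P).
apply/eqP; rewrite eqn_leq; apply/andP; split; last first.
  by apply: mem_le_maxT; rewrite e mem_head.
rewrite /maxT; have : {in flatten (mu i T), forall x, x <= (maxT T).+1}.
  move=> x; rewrite e inE => /orP[/eqP->//|/mem_le_maxT]; exact: leqW.
by elim: (flatten (mu i T)) => //= x s IH h; rewrite geq_max h ?mem_head //= IH // => y ys;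
   apply: h; rewrite inE ys orbT.
Qed.

Lemma count_ltnS k s : count (ltn k) s = count (ltn k.+1) s + count_mem k.+1 s.
Proof. by elim: s => //= x s ->; case: (ltngtP x k.+1); lia. Qed.

(* The two letters differ when the entry [k.+1] itself moves one column to the
   right.  In the sorted tableau it then moves along its row, whence the
   equality of column lengths. *)
Lemma level_step k i T : mu_spec i T -> k < maxT T ->
  level k i T = level k.+1 i T \/
  exists c, [/\ level k.+1 i T = c.+1, level k i T = c.+2 &
                nabove T k.+1 c = nabove T k.+1 c.+1].
Proof.
move=> P kT; have uG : uniq (mu_row i T).
  by apply: (sorted_uniq gtn_trans) (mu_row_decreasing P) => x; rewrite /= ltnn.
have e : level k i T = level k.+1 i T + (k.+1 \in mu_row i T).
  by rewrite /level -count_uniq_mem // count_ltnS.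
case: (boolP (_ \in _)) e => [h|_] /= e; [right|left; lia].
have l0 := level_gt0 i kT; exists (level k.+1 i T).-1.
rewrite prednK //; split; [by []|lia|].
have eG : nth 0 (mu_row i T) (level k.+1 i T) = k.+1.
  have h1 : k < nth 0 (mu_row i T) (level k.+1 i T).
    by rewrite nth_mu_row //; lia.
  have : ~~ (k.+1 < nth 0 (mu_row i T) (level k.+1 i T)).
    by rewrite nth_mu_row // ltnn.
  by lia.
have li : level k.+1 i T < i.
  by rewrite -[X in _ < X](mu_row_size P) ltnNge; apply/negP => h'; move: eG; rewrite nth_default.
have := @mu_above _ _ P (level k.+1 i T).-1; rewrite prednK // eG; exact.
Qed.

Lemma valid_mu T j js : good T -> valid T (j :: js) -> mu_spec j T /\ valid (mu j T) js.
Proof. by move=> gT /and3P[j0 hj hv]; split=> //; apply: muP. Qed.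

(** The two sides are the numbers of entries above [k] in adjacent columns after the slides recorded
    by [l1]; rows decrease weakly. *)
Lemma level_word_prefix k T js l1 l2 c : good T -> valid T js -> level_word k T js = l1 ++ l2 ->
  nabove T k c.+1 + count_mem c.+2 l1 <= nabove T k c + count_mem c.+1 l1.
Proof.
elim: js T l1 => [|j js IH] T [|x l1] gT hv //=; try by move=> _; rewrite !addn0 nabove_row_le.
have [P hv'] := valid_mu gT hv.
case=> ex /(IH _ _ (mu_good P) hv'); rewrite !(nabove_mu _ _ P) ex !(eq_sym x).
by rewrite -!addnA.
Qed.

Lemma nabove_foldl k T js c : good T -> valid T js ->
  nabove (foldl (fun U j => mu j U) T js) k c = nabove T k c + count_mem c.+1 (level_word k T js).
Proof.
elim: js T => [|j js IH] T gT hv /=; first by rewrite addn0.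
have [P hv'] := valid_mu gT hv.
by rewrite (IH _ (mu_good P) hv') (nabove_mu _ _ P) eq_sym addnA.
Qed.

(** Ballot criterion. The induction also carries the balance: unmatched c minus unmatched c+1 equals
    the difference of the letter counts. *)
Lemma bracket_prefix0 c S : (forall S1 S2, S = S1 ++ S2 -> count_mem c S1 <= count_mem c.+1 S1) ->
  (bracket c S).1 = 0.
Proof.
suff h : (bracket c S).1 + count_mem c.+1 S = (bracket c S).2 + count_mem c S /\
  ((forall S1 S2, S = S1 ++ S2 -> count_mem c S1 <= count_mem c.+1 S1) -> (bracket c S).1 = 0).
  by case: h.
elim/last_ind: S => [|S x [IH1 IH2]] //; rewrite -cats1 bracket_cat !count_cat /=.
rewrite /bmul /bgen /= !subn0 !addn0.
split.
  move: IH1; move: (count_mem c.+1 _) (count_mem c _) => p q.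
  by move: (x == c) (x == c.+1) => b1 b2; lia.
move=> h; have := h (S ++ [:: x]) [::]; rewrite cats0 !count_cat /= => /(_ erefl).
have -> := IH2 _; last by move=> S1 S2 e; apply: (h S1 (S2 ++ [:: x])); rewrite e catA.
move: IH1; rewrite IH2 => [|S1 S2 e]; last by apply: (h S1 (S2 ++ [:: x])); rewrite e catA.
have : ~~ ((x == c) && (x == c.+1)) by apply/andP => -[/eqP->]; rewrite (ltn_eqF (ltnSn c)).
move: (count_mem c.+1 _) (count_mem c _) (x == c) (x == c.+1) => p q b1 b2; lia.
Qed.

Lemma bracket_suffix0 c A : (forall A1 A2, A = A1 ++ A2 -> count_mem c.+1 A2 <= count_mem c A2) ->
  (bracket c A).2 = 0.
Proof.
suff h : (bracket c A).1 + count_mem c.+1 A = (bracket c A).2 + count_mem c A /\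
  ((forall A1 A2, A = A1 ++ A2 -> count_mem c.+1 A2 <= count_mem c A2) -> (bracket c A).2 = 0).
  by case: h.
elim: A => [|x A [IH1 IH2]] //; rewrite bracket_cons /bmul /bgen /=.
split.
  move: IH1; move: (count_mem c.+1 _) (count_mem c _) => p q.
  by move: (x == c) (x == c.+1) => b1 b2; lia.
move=> h; have := h [::] (x :: A) erefl.
have e2 := IH2 (fun A1 A2 e => h (x :: A1) A2 (congr1 (cons x) e)).
have : ~~ ((x == c) && (x == c.+1)) by apply/andP => -[/eqP->]; rewrite (ltn_eqF (ltnSn c)).
move: IH1; rewrite /= e2.
move: (count_mem c.+1 _) (count_mem c _) (x == c) (x == c.+1) => p q b1 b2; lia.
Qed.

(** Letters are exchanged in the order of the slides. [S] holds those of past slides, latest first,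
    already at threshold k+1. Its hypothesis says that undoing the latest slides [S1] leaves column
    counts that decrease weakly. *)
Lemma growth T js k S : good T -> valid T js -> k < maxT T ->
  (forall c S1 S2, S = S1 ++ S2 ->
     nabove T k.+1 c.+1 + count_mem c.+1 S1 <= nabove T k.+1 c + count_mem c.+2 S1) ->
  ishape (rev (level_word k T js) ++ S) = ishape (rev (level_word k.+1 T js) ++ S).
Proof.
elim: js T S => [|j js IH] T S gT hv kT hS //=.
have [P hv'] := valid_mu gT hv; have g' := mu_good P.
have k' : k < maxT (mu j T) by rewrite maxT_mu // ltnW.
(* Induction treats the later letters with the current one already lowered, so only the current
   letter remains to be exchanged. *)
rewrite !rev_cons !cat_rcons -[RHS]IH //; last first.
  move=> c [|x S1] S2; first by rewrite !addn0 nabove_row_le.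
  case=> <- e; move: (hS c S1 S2 e); rewrite !(nabove_mu _ _ P) /= !(eq_sym (level _ _ _)); lia.
case: (level_step P kT) => [->//|[c [e1 e2 e3]]].
rewrite e1 e2; apply: ishape_lower.
  apply: bracket_suffix0 => A1 A2 eA.
  have := @level_word_prefix k (mu j T) js (rev A2) (rev A1) c g' hv'.
  rewrite -rev_cat -eA revK => /(_ erefl); rewrite !count_rev !(nabove_mu _ _ P) e2.
  rewrite eqxx (ltn_eqF (ltnSn c.+1)).
  (* Column c may count the single entry k+1 more at threshold k; the box that the slide adds in
     column c+1 makes up for it. *)
  have : nabove T k c <= nabove T k.+1 c + 1.
    by rewrite !nabove_col count_ltnS leq_add2l count_uniq_mem ?good_uniq // leq_b1.
  have : nabove T k.+1 c.+1 <= nabove T k c.+1.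
    by apply: sub_count => row /=; lia.
  rewrite e3; lia.
by apply: bracket_prefix0 => S1 S2 e; move: (hS c S1 S2 e); rewrite e3 leq_add2l.
Qed.

Lemma level_word0 T js : good T -> valid T js -> level_word 0 T js = js.
Proof.
elim: js T => //= j js IH T gT hv; have [P hv'] := valid_mu gT hv.
by rewrite level_size // IH //; apply: mu_good P.
Qed.

Lemma ishape_level_word T js k : good T -> valid T js -> k <= maxT T ->
  ishape (rev js) = ishape (rev (level_word k T js)).
Proof.
move=> gT hv; elim: k => [|k IH] hk; first by rewrite level_word0.
have := @growth T js k [::] gT hv hk; rewrite !cats0 => <-; first exact: IH (ltnW hk).
by move=> c [|//] S2 _; rewrite !addn0 nabove_row_le.
Qed.

Lemma level_word_letters k T js : good T -> valid T js -> k <= maxT T -> 0 \notin level_word k T js.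
Proof.
elim: js T => //= j js IH T gT hv hk; have [P hv'] := valid_mu gT hv.
rewrite inE negb_or eq_sym -lt0n level_gt0 // IH //; first exact: mu_good P.
by rewrite maxT_mu // leqW.
Qed.

Lemma ishape_columns T js : good T -> valid T js ->
  sorted geq (ishape (rev js)) /\
  forall c, count (ltn c) (ishape (rev js)) =
            nabove (foldl (fun U j => mu j U) T js) (maxT T) c.
Proof.
move=> gT hv; have n0 c : nabove T (maxT T) c = 0.
  rewrite nabove_col; apply/eqP; rewrite -leqn0 leqNgt -has_count; apply/hasP => -[x].
  by move=> /col_flatten/mem_le_maxT /=; lia.
rewrite (ishape_level_word gT hv (leqnn _)).
have [||h1 _ h2] := @ishape_yamanouchi (rev (level_word (maxT T) T js)).
- by rewrite mem_rev level_word_letters.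
- case=> // c _; apply: bracket_suffix0 => A1 A2 eA.
  have := @level_word_prefix (maxT T) T js (rev A2) (rev A1) c gT hv.
  by rewrite -rev_cat -eA revK !n0 !count_rev => /(_ erefl).
split=> // c; by rewrite nabove_foldl // n0 add0n -(count_rev _ (level_word _ _ _)); apply: h2.
Qed.

(** * The bijection rho *)

(** The conditions of [good] that do not concern distinctness: all that is known of a preimage of
    the recording tableau under [rho]. *)
Record ssrct (T : tab) : Prop := Ssrct {
  ssrct_positive : positive_rows T;
  ssrct_row : forall r c, entry T r c.+1 <= entry T r c;
  ssrct_first : forall r s, r < s -> s < size T -> entry T r 0 < entry T s 0;
  ssrct_trip : forall r s c, r < s -> 0 < entry T s c.+1 ->
    entry T s c.+1 <= entry T r c -> entry T s c.+1 < entry T r c.+1 }.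

Lemma good_ssrct T : good T -> ssrct T.
Proof. by case. Qed.

Lemma tab_ext A B : positive_rows A -> positive_rows B ->
  (forall r c, entry A r c = entry B r c) -> A = B.
Proof.
move=> pA pB e.
have le_size X Y : positive_rows X -> positive_rows Y ->
    (forall r c, entry X r c = entry Y r c) -> size X <= size Y.
  move=> pX pY eXY; case: (posnP (size X)) => [-> //|X0].
  have lX : (size X).-1 < size X by rewrite prednK.
  have := entry_gt0 (size X).-1 0 pX; rewrite lX.
  have /andP[-> _] := allP pX _ (mem_nth [::] lX).
  by rewrite eXY entry_gt0 // prednK // => /andP[].
apply: (@eq_from_nth _ [::]).
  by apply/eqP; rewrite eqn_leq !le_size.
move=> r rA; have rB : r < size B by apply: leq_trans rA (le_size _ _ pA pB e).
have sz c : (c < size (nth [::] A r)) = (c < size (nth [::] B r)).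
  by have := entry_gt0 r c pA; rewrite e entry_gt0 // rA rB.
apply: (@eq_from_nth _ 0) => [|c _]; last exact: e.
by apply/eqP; rewrite eqn_leq [_ <= _]leqNgt sz ltnn /= leqNgt -sz ltnn.
Qed.

Lemma nz_ext (s s' : seq nat) : 0 \notin s -> 0 \notin s' ->
  (forall k, nth 0 s k = nth 0 s' k) -> s = s'.
Proof.
elim: s s' => [|x s IH] [|y s'] //=.
- by move=> _; rewrite inE negb_or => /andP[/eqP y0 _] /(_ 0).
- by rewrite inE negb_or => /andP[/eqP y0 _] _ /(_ 0) /= e; case: y0.
rewrite !inE !negb_or => /andP[_ s0] /andP[_ s0'] e.
by have /= -> := e 0; rewrite (IH s') // => k; apply: (e k.+1).
Qed.

Lemma sort_geq_eq s s' : perm_eq s s' -> sorted geq s' -> sort geq s = s'.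
Proof.
move=> p ss; apply: (sorted_eq geq_trans) => //.
- by move=> a b /andP[/= ab ba]; apply/anti_leq/andP.
- by apply: sort_sorted => a b /=; apply: leq_total.
- by rewrite perm_sort.
Qed.

Lemma sorted_geq_head (x : nat) s y : sorted geq (x :: s) -> y \in x :: s -> y <= x.
Proof.
rewrite /= (path_sortedE geq_trans) inE => /andP[/allP h _] /orP[/eqP->//|/h].
by [].
Qed.

Lemma nth_sorted_geq_head (x : nat) s c : sorted geq (x :: s) -> nth 0 (x :: s) c <= x.
Proof.
move=> h; have [ci|ci] := ltnP c (size (x :: s)); last by rewrite nth_default.
by apply: sorted_geq_head h _; apply: mem_nth.
Qed.

Lemma ssrct_row_sorted T row : ssrct T -> row \in T -> sorted geq row.
Proof. by move=> wT /(nthP [::])[r _ <-]; apply/(sortedP 0) => c _; apply: ssrct_row wT r c. Qed.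

Definition col_rows (cols : tab) : tab :=
  [seq [seq nth 0 cl k | cl <- cols & k < size cl]
  | k <- iota 0 (foldr maxn 0 (map size cols))].

Lemma foldr_maxn_lt (s : seq nat) k : k < foldr maxn 0 s -> has (ltn k) s.
Proof. by elim: s => //= y s IH; rewrite leq_max => /orP[->//|/IH ->]; rewrite orbT. Qed.

Lemma nth_col_rows (cols : tab) k c : sorted geq (map size cols) ->
  nth 0 [seq nth 0 cl k | cl <- cols & k < size cl] c = nth 0 (nth [::] cols c) k.
Proof.
elim: cols c => [|cl cols IH] c hs; first by rewrite /= !nth_nil.
rewrite /=; have [kc|kc] := ltnP k (size cl).
  by case: c => [|c] //=; rewrite IH //; apply: path_sorted hs.
have hk d : d \in cols -> size d <= k.
  move=> dc; apply: leq_trans kc; apply: sorted_geq_head hs _.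
  by rewrite inE map_f ?orbT.
have -> : [seq x <- cols | k < size x] = [::].
  by rewrite (eq_in_filter (a2 := pred0)) ?filter_pred0 // => d /hk; rewrite leqNgt => /negPf.
rewrite /= nth_nil; case: c => [|c] /=; first by rewrite nth_default.
have [ci|ci] := ltnP c (size cols); last by rewrite (nth_default [::] ci) nth_nil.
by rewrite (nth_default 0) // hk // mem_nth.
Qed.

Lemma entry_col_rows (cols : tab) k c : sorted geq (map size cols) ->
  entry (col_rows cols) k c = nth 0 (nth [::] cols c) k.
Proof.
move=> hs; rewrite /entry /col_rows; set M := foldr _ _ _.
have [kM|kM] := ltnP k M.
  by rewrite (nth_map 0) ?size_iota // nth_iota // add0n nth_col_rows.
rewrite (nth_default [::]) ?size_map ?size_iota // nth_nil.
have [ci|ci] := ltnP c (size cols); last by rewrite (nth_default [::] ci) nth_nil.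
rewrite nth_default //; apply: leq_trans kM; apply: foldr_maxn_le.
by rewrite map_f ?mem_nth.
Qed.

Lemma positive_col_rows (cols : tab) : 0 \notin flatten cols -> positive_rows (col_rows cols).
Proof.
move=> h; apply/allP => row /mapP[k]; rewrite mem_iota add0n /= => kM ->.
apply/andP; split.
  rewrite size_map size_filter -has_count.
  by have := foldr_maxn_lt kM; rewrite has_map.
apply: contra h => /mapP[cl]; rewrite mem_filter => /andP[kc hc] e.
by apply/flattenP; exists cl => //; rewrite e mem_nth.
Qed.

Definition tab_cols (S : tab) : tab :=
  [seq sort geq (col S c) | c <- iota 0 (foldr maxn 0 (map size S))].

Lemma rho_col_rows S : positive_rows S -> rho S = col_rows (tab_cols S).
Proof.
move=> pS; rewrite /rho /col_rows /tab_cols; set cols := [seq sort geq _ | c <- _].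
suff -> : cols = [seq sort geq (col S c) | c <- iota 0 (foldr maxn 0 (map size S))] by [].
apply: eq_map => c; congr sort; rewrite /col map_nth_entry /mkseq filter_map.
congr map; apply: eq_in_filter => r; rewrite mem_iota add0n /= => rS.
by have := entry_gt0 r c pS; rewrite rS lt0n.
Qed.

Lemma size_col T c : size (col T c) = nabove T 0 c.
Proof.
rewrite nabove_col -count_predT; apply: eq_in_count => x.
by rewrite mem_filter /= lt0n => /andP[-> _].
Qed.

Lemma size_col_le T c : ssrct T -> size (col T c.+1) <= size (col T c).
Proof.
move=> wT; rewrite !size_col; apply: sub_in_count => row /(nthP [::])[r _ <-] h.
exact: leq_trans h (ssrct_row wT r c).
Qed.

Lemma col_notin0 T c : 0 \notin col T c.
Proof. by rewrite mem_filter. Qed.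

Lemma col_wide T c : foldr maxn 0 (map size T) <= c -> col T c = [::].
Proof.
move=> hc; rewrite /col; have -> : [seq nth 0 row c | row <- T] = [seq 0 | _ <- T].
  apply/eq_in_map => row rT; rewrite nth_default //; apply: leq_trans hc.
  by apply: foldr_maxn_le; rewrite map_f.
by elim: (T).
Qed.

Lemma entry_rho S k c : ssrct S -> entry (rho S) k c = nth 0 (sort geq (col S c)) k.
Proof.
move=> wS; rewrite rho_col_rows ?ssrct_positive // entry_col_rows.
  rewrite /tab_cols; set W := foldr _ _ _; have [cW|cW] := ltnP c W.
    by rewrite (nth_map 0) ?size_iota // nth_iota.
  by rewrite (nth_default [::]) ?size_map ?size_iota // col_wide.
rewrite /tab_cols -map_comp; apply/(sortedP 0) => i; rewrite size_map size_iota => hi.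
rewrite !(nth_map 0) ?size_iota ?(ltnW hi) // !nth_iota ?(ltnW hi) //= !size_sort.
exact: size_col_le.
Qed.

Lemma positive_rho S : ssrct S -> positive_rows (rho S).
Proof.
move=> wS; rewrite rho_col_rows; last exact: ssrct_positive.
apply: positive_col_rows.
apply/negP => /flattenP[cl /mapP[c _ ->]]; rewrite mem_sort.
by apply/negP/col_notin0.
Qed.

Lemma rho_perm S B : ssrct S -> ssrct B -> rho S = rho B ->
  forall c, perm_eq (col S c) (col B c).
Proof.
move=> wS wB e c; rewrite -(perm_sort geq) perm_sym -(perm_sort geq).
suff -> : sort geq (col B c) = sort geq (col S c) by [].
by apply: nz_ext; rewrite ?mem_sort ?col_notin0 // => k; rewrite -!entry_rho // e.
Qed.

Lemma entry_mem T r c : 0 < entry T r c -> entry T r c \in col T c.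
Proof. by move=> h; apply/mem_col; exists r. Qed.

Lemma rho_inj_step S B c x r :
  ssrct S -> ssrct B -> (forall r, entry S r c = entry B r c) ->
  perm_eq (col S c.+1) (col B c.+1) ->
  (forall y r, x < y -> entry S r c.+1 = y <-> entry B r c.+1 = y) ->
  0 < x -> entry S r c.+1 = x -> entry B r c.+1 = x.
Proof.
move=> wS wB ec p IH x0 eS.
have : x \in col B c.+1 by rewrite -(perm_mem p) -eS entry_mem // eS.
case/mem_col => s eB _; case: (ltngtP r s) => [rs|sr|->]; last by rewrite eB.
  have := ssrct_trip wB rs (c := c); rewrite -eB => /(_ x0).
  rewrite -ec -{1}eS => /(_ (ssrct_row wS r c)) h.
  by have := (IH _ r h).2 erefl; rewrite eS; lia.
have := ssrct_trip wS sr (c := c); rewrite eS => /(_ x0).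
rewrite ec {1}eB => /(_ (ssrct_row wB s c)) h.
by have := (IH _ s h).1 erefl; rewrite -eB; lia.
Qed.

(** Columns are recovered from left to right: the first by sorting, each later one from its largest
    entry downwards. *)
Lemma rho_inj S B : ssrct S -> ssrct B -> rho S = rho B -> S = B.
Proof.
move=> wS wB e; have p := rho_perm wS wB e.
apply: tab_ext; [exact: ssrct_positive|exact: ssrct_positive|move=> r c].
elim: c r => [|c IH] r.
  have col0 T : ssrct T -> sorted ltn (col T 0) /\ forall r, entry T r 0 = nth 0 (col T 0) r.
    move=> wT; have -> : col T 0 = mkseq (entry T ^~ 0) (size T).
      rewrite /col map_nth_entry; apply/all_filterP/allP => x /mapP[i].
      rewrite mem_iota add0n /= => iT ->; rewrite -lt0n entry_gt0 ?ssrct_positive // iT.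
      by have /andP[] := allP (ssrct_positive wT) _ (mem_nth [::] iT).
    split=> [|i].
      apply/(sortedP 0) => i; rewrite size_mkseq => iT.
      by rewrite !nth_mkseq ?(ltnW iT) //; apply: ssrct_first.
    have [iT|iT] := ltnP i (size T); first by rewrite nth_mkseq.
    by rewrite entry_default // nth_default ?size_mkseq.
  have [s1 ->] := col0 S wS; have [s2 ->] := col0 B wB; congr nth.
  have anti : antisymmetric ltn by move=> a b /andP[/= ab ba]; lia.
  exact: (sorted_eq ltn_trans anti s1 s2 (p 0)).
suff h x i : 0 < x -> entry S i c.+1 = x <-> entry B i c.+1 = x.
  have [e0|e0] := posnP (entry S r c.+1); last by symmetry; apply/h.
  have [e1|e1] := posnP (entry B r c.+1); first by rewrite e0 e1.
  exact: (h _ _ e1).2.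
pose M := maxn (maxT S) (maxT B).
have big y T : y \in col T c.+1 -> y <= maxT T by move/col_flatten/mem_le_maxT.
have bigS j : entry S j c.+1 <= M.
  case: (posnP (entry S j c.+1)) => [->//|h]; apply: (leq_trans (big _ S (entry_mem h))).
  exact: leq_maxl.
have bigB j : entry B j c.+1 <= M.
  case: (posnP (entry B j c.+1)) => [->//|h]; apply: (leq_trans (big _ B (entry_mem h))).
  exact: leq_maxr.
have [m] := ubnP (M - x); elim: m x i => // m IHm x i hm x0.
have IH' y j : x < y -> entry S j c.+1 = y <-> entry B j c.+1 = y.
  move=> xy; have [yM|yM] := leqP y M; first by apply: IHm; lia.
  by split=> ey; [have := bigS j | have := bigB j]; lia.
split; first exact: rho_inj_step.
apply: rho_inj_step => //; first by rewrite perm_sym.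
by move=> y j xy; split=> h; apply/(IH' _ _ xy).
Qed.

(** * Bullets *)

(* The bullets of the bullet convention, relabelled from 1. *)
Definition bullets (n : nat) (T : tab) : tab :=
  [seq [seq x - n | x <- row & n < x] | row <- T & n < head 0 row].

Definition run (T : tab) (js : seq nat) : tab := foldl (fun U j => mu j U) T js.

Definition first_bullet (n : nat) (T : tab) : nat := find (fun row => n < head 0 row) T.

Lemma nth_bullets_row n row c : sorted geq row ->
  nth 0 [seq x - n | x <- row & n < x] c = nth 0 row c - n.
Proof.
elim: row c => [|x s IH] c hs /=; first by rewrite !nth_nil.
have [nx|xn] := ltnP n x; first by case: c => [|c] //=; rewrite IH // (path_sorted hs).
have -> : [seq y <- s | n < y] = [::].
  rewrite (eq_in_filter (a2 := pred0)) ?filter_pred0 // => y ys.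
  have : y <= x by apply: sorted_geq_head hs _; rewrite inE ys orbT.
  by move=> yx; apply/negbTE; rewrite -leqNgt (leq_trans yx).
rewrite nth_nil; symmetry; apply/eqP; rewrite subn_eq0.
exact: leq_trans (nth_sorted_geq_head c hs) xn.
Qed.

(** The first column increases, so the rows that begin with a bullet form a final segment. *)
Lemma filter_bullets n T : ssrct T ->
  [seq row <- T | n < head 0 row] = drop (first_bullet n T) T.
Proof.
move=> wT; set d := first_bullet n T; rewrite -{1}(cat_take_drop d T) filter_cat.
rewrite (eq_in_filter (a2 := pred0)) ?filter_pred0 /=; last first.
  move=> row /(nthP [::])[i]; rewrite size_take_min leq_min => /andP[id' _] <-.
  by rewrite nth_take //; apply: (before_find [::] id').
apply/all_filterP/(all_nthP [::]) => i; rewrite size_drop => hi; rewrite nth_drop.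
have dT : d < size T by lia.
have hd : n < head 0 (nth [::] T d).
  by apply: (@nth_find _ [::] (fun row => n < head 0 row)); rewrite has_find.
rewrite -nth0 in hd; rewrite -nth0; case: i hi => [|i] hi; first by rewrite addn0.
by apply: ltn_trans hd _; apply: (ssrct_first wT); lia.
Qed.

Lemma entry_bullets n T r c : ssrct T ->
  entry (bullets n T) r c = entry T (first_bullet n T + r) c - n.
Proof.
move=> wT; rewrite /bullets filter_bullets // /entry -nth_drop.
have [rd|rd] := ltnP r (size (drop (first_bullet n T) T)); last first.
  by rewrite !(nth_default [::]) ?size_map // !nth_nil.
rewrite (nth_map [::]) // nth_bullets_row //; apply: (ssrct_row_sorted wT).
exact: mem_drop (mem_nth _ rd).
Qed.

Lemma size_bullets n T : ssrct T -> size (bullets n T) = size T - first_bullet n T.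
Proof. by move=> wT; rewrite size_map filter_bullets // size_drop. Qed.

Lemma positive_bullets n T : positive_rows (bullets n T).
Proof.
apply/allP => row' /mapP[row]; rewrite mem_filter => /andP[hd _] ->; apply/andP; split.
  by rewrite size_map size_filter -has_count; case: row hd => //= x s ->.
by apply/negP => /mapP[x]; rewrite mem_filter => /andP[nx _]; lia.
Qed.

Lemma ssrct_bullets n T : ssrct T -> ssrct (bullets n T).
Proof.
move=> wT; split; first exact: positive_bullets.
- by move=> r c; rewrite !entry_bullets // leq_sub2r // ssrct_row.
- move=> r s rs; rewrite size_bullets // !entry_bullets // => sT.
  have hd : n < entry T (first_bullet n T + s) 0.
    have sp : s < size (bullets n T) by rewrite size_bullets.
    have := entry_gt0 s 0 (positive_bullets n T); rewrite sp entry_bullets // subn_gt0 => -> /=.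
    by have /andP[] := allP (positive_bullets n T) _ (mem_nth [::] sp).
  apply: ltn_sub2r => //; apply: (ssrct_first wT); [by rewrite ltn_add2l | lia].
move=> r s c rs; rewrite !entry_bullets // subn_gt0 => h1 h2.
have h3 : first_bullet n T + r < first_bullet n T + s by rewrite ltn_add2l.
have := ssrct_trip wT h3 (leq_ltn_trans (leq0n _) h1); lia.
Qed.

Lemma col_bullets n T c : ssrct T -> col (bullets n T) c = [seq x - n | x <- col T c & n < x].
Proof.
move=> wT; have hs row : row \in T -> sorted geq row by apply: ssrct_row_sorted.
rewrite /col /bullets; elim: (T) hs => //= row s IH hs.
have {}IH := IH (fun r rs => hs r (mem_behead (s := row :: s) rs)).
have hrow := hs row (mem_head _ _).
have hd : nth 0 row c <= head 0 row.
  by case: (row) hrow => [|x r] hr; [rewrite nth_nil | apply: (nth_sorted_geq_head c hr)].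
have [nh|nh] := ltnP n (head 0 row); last first.
  rewrite IH; case: eqP => //= _.
  by rewrite ltnNge (leq_trans hd nh).
rewrite /= nth_bullets_row // IH subn_eq0 -ltnNge.
have [nc|nc] := ltnP n (nth 0 row c); last by case: eqP => //= _; rewrite ltnNge nc.
by rewrite (gtn_eqF (leq_ltn_trans (leq0n n) nc)) /= nc.
Qed.

Lemma sort_bullets_succ n s :
  sort geq [seq x - n | x <- s & n < x] =
  [seq x.+1 | x <- sort geq [seq x - n.+1 | x <- s & n.+1 < x]] ++ nseq (count_mem n.+1 s) 1.
Proof.
apply: sort_geq_eq.
  rewrite (perm_trans (y := [seq x.+1 | x <- [seq x - n.+1 | x <- s & n.+1 < x]] ++
      nseq (count_mem n.+1 s) 1)) //; last first.
    by rewrite perm_cat2r perm_map // perm_sym perm_sort.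
  apply/permP => q; rewrite count_cat; elim: s => //= x s IH.
  case: (ltngtP n.+1 x) => h /=.
  - by rewrite IH subnSK ?(ltnW h) // addnA.
  - by rewrite IH.
  by rewrite -h IH subSnn addnCA.
rewrite (sorted_pairwise geq_trans) pairwise_cat; apply/and3P; split.
- by apply/allrelP => x y /mapP[z _ ->]; rewrite mem_nseq => /andP[_ /eqP->].
- rewrite pairwise_map -(sorted_pairwise (leT := relpre succn geq)).
    by apply: sub_sorted (sort_sorted (leT := geq) _ _) => [a b //|a b]; apply: leq_total.
  by move=> y x z /= xy yz; apply: leq_trans yz xy.
by elim: (count_mem _ _) => //= m ->; rewrite andbT all_nseq /= orbT.
Qed.

Lemma size_col_bullets n T c : ssrct T -> size (col (bullets n T) c) = nabove T n c.
Proof. by move=> wT; rewrite col_bullets // size_map size_filter nabove_col. Qed.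

Lemma positive_map_succ Q : positive_rows Q -> positive_rows (map (map succn) Q).
Proof.
move=> pQ; apply/allP => row /mapP[row' /(allP pQ) /andP[h _] ->].
by rewrite size_map h /=; apply/negP => /mapP[].
Qed.

Lemma positive_add_box Q r v : positive_rows Q -> r <= size Q -> 0 < v ->
  positive_rows (add_box Q r v).
Proof.
rewrite /positive_rows /add_box => + + v0; elim: Q r => [|row Q IH] [|r] //=.
- by rewrite inE eq_sym -lt0n v0.
- move=> /andP[/andP[_ h] ->] _; rewrite size_rcons mem_rcons inE negb_or h !andbT /=.
  by rewrite eq_sym -lt0n.
by move=> /andP[-> hQ] rQ /=; apply: IH.
Qed.

Lemma entry_add_box Q r v i c :
  entry (add_box Q r v) i c =
  if (i == r) && (c == size (nth [::] Q r)) then v else entry Q i c.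
Proof.
rewrite /entry /add_box nth_set_nth /=; case: eqP => [->|] //=.
rewrite nth_rcons; case: ltngtP => // h; by rewrite nth_default // ltnW.
Qed.

Lemma entry_map_succ Q i c : positive_rows Q ->
  entry (map (map succn) Q) i c = if 0 < entry Q i c then (entry Q i c).+1 else 0.
Proof.
move=> pQ; rewrite entry_gt0 //; case: ltnP => iQ /=; last first.
  by rewrite /entry (nth_default [::]) ?size_map ?nth_nil.
rewrite /entry (nth_map [::]) //; case: ltnP => cQ; first by rewrite (nth_map 0).
by rewrite nth_default // size_map.
Qed.

Lemma good_run T js : good T -> valid T js -> good (run T js).
Proof.
elim: js T => //= j js IH T gT hv; have [P hv'] := valid_mu gT hv.
exact: IH (mu_good P) hv'.
Qed.

(** The final tableau [F] stays fixed while the first slide is split off. The remaining slides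
    describe the bullets above n+1; going back to n raises their labels and adds label 1 for the
    entry n+1. Its box is the one by which the two insertion shapes differ. *)
Lemma rho_bullets_run T js : good T -> valid T js ->
  rho (bullets (maxT T) (run T js)) = recording (std (rev js)).
Proof.
elim: js T => [|j js IH] T gT hv.
  suff -> : bullets (maxT T) T = [::] by [].
  rewrite /bullets (eq_in_filter (a2 := pred0)) ?filter_pred0 // => row rT /=.
  apply/negbTE; rewrite -leqNgt; apply: mem_le_maxT; apply/flattenP; exists row => //.
  by have /andP[] := allP (good_positive gT) _ rT; case: (row) => //= x s _ _; apply: mem_head.
have [P hv'] := valid_mu gT hv; have g' := mu_good P.
have [_ cols'] := ishape_columns gT hv; have [s2 cols2] := ishape_columns g' hv'.
have [s1 _] := ishape_columns gT hv.
have {}IH := IH _ g' hv'; rewrite maxT_mu // in IH cols2.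
rewrite rev_cons in s1 cols' *.
have gF : good (run T (j :: js)) by apply: good_run.
have eF : run (mu j T) js = run T (j :: js) by [].
rewrite -/(run _ _) eF in IH cols2; rewrite -/(run _ _) in cols'.
move: (run T (j :: js)) gF IH cols' cols2 {eF} => F gF IH cols1 cols2.
set n := maxT T in IH cols1 cols2 *; set w := rev js in IH cols1 cols2 s1 s2 *.
have [-> szQ rQ] := recording_rcons w j.
rewrite ishape_rcons in s1 cols1.
move: (ins leq _ j).2 rQ s1 cols1 => r rQ s1 cols1.
have wF := good_ssrct gF.
have pQ : positive_rows (recording (std w)).
  by rewrite -IH; apply/positive_rho/ssrct_bullets.
have rQ' : r <= size (recording (std w)) by rewrite -(size_map size) szQ.
apply: tab_ext.
- exact/positive_rho/ssrct_bullets.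
- by apply: positive_add_box => //; [apply: positive_map_succ | rewrite size_map].
move=> i c; rewrite entry_add_box entry_map_succ // -IH.
rewrite !entry_rho; try exact: ssrct_bullets.
have szr : size (nth [::] (map (map succn) (recording (std w))) r) = nth 0 (ishape w) r.
  rewrite -szQ; have [h|h] := ltnP r (size (recording (std w))).
    by rewrite !(nth_map [::]) // size_map.
  by rewrite !nth_default ?size_map.
rewrite IH szr !col_bullets // sort_bullets_succ nth_cat size_map size_sort -col_bullets // size_col_bullets //.
have eN := count_ltnS n (col F c); rewrite -!nabove_col in eN.
(* Conjugation: column c has more than i bullets exactly when row i of the insertion shape is longer
   than c. *)
have hi k (s : seq nat) : sorted geq s -> count (ltn c) s = nabove F k c ->
    (i < nabove F k c) = (c < nth 0 s i) by move=> ss <-; rewrite nth_sorted_geq_count.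
have h1 := hi n _ s1 (cols1 c); have h2 := hi n.+1 _ s2 (cols2 c).
rewrite nth_incr_nth in h1.
have [iN|iN] := ltnP i (nabove F n.+1 c).
  rewrite (nth_map 0) ?size_sort ?size_col_bullets // ifN; last first.
    by rewrite iN in h2; apply/andP => -[/eqP ei /eqP ec]; move: h2; rewrite ei ec ltnn.
  rewrite ifT //.
  have : nth 0 (sort geq (col (bullets n.+1 F) c)) i \in col (bullets n.+1 F) c.
    by rewrite -(mem_sort geq) mem_nth // size_sort size_col_bullets.
  by case/mem_col.
rewrite [nth 0 (sort _ _) i]nth_default ?size_sort ?size_col_bullets //=.
rewrite nth_nseq; move: h1 h2; rewrite eN [i < nabove F n.+1 c]ltnNge iN /=.
case: (eqVneq r i) => [ri|ri] /= h1 h2; first subst i.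
  case: eqP => [ec|ec]; first by rewrite ifT //; lia.
  by rewrite ifF //; lia.
by rewrite ifF //; lia.
Qed.

(** * Return to the definitions of SSRCT and SRCT *)

Lemma is_comp_shape T : positive_rows T -> is_comp (map size T).
Proof. by move=> pT; rewrite /is_comp all_map; apply: sub_all pT => row /andP[]. Qed.

Lemma in_diag_positive T r c : positive_rows T -> in_diag T r c = (0 < entry T r c).
Proof. by move=> pT; rewrite entry_gt0. Qed.

Lemma ssrct_of_straight T alpha : is_SSRCT T alpha [::] -> map size T = alpha /\ ssrct T.
Proof.
case=> /and5P[/eqP <- hc _ _ /allP hs] h1 h2 h3; split=> //.
have pT : positive_rows T.
  apply/allP => row /(nthP [::])[r rT <-]; apply/andP; split.
    by move: hc; rewrite /is_comp all_map => /allP/(_ _ (mem_nth [::] rT)).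
  apply/negP => /(nthP 0)[c cr e].
  have := hs r; rewrite mem_iota add0n size_map rT => /(_ isT) /andP[_ /allP /(_ c)].
  rewrite (nth_map [::]) // mem_iota add0n cr => /(_ isT).
  rewrite /entry e eqxx cats0 nth_nseq if_same ltn0.
  by [].
have fE r c : filled T r c = (0 < entry T r c).
  by rewrite /filled in_diag_positive // -lt0n andbb.
have iE r c : inner T r c = false.
  by rewrite /inner in_diag_positive // lt0n andNb.
split=> //.
- move=> r c; case: (posnP (entry T r c.+1)) => [->//|h].
  apply: (h1 r c c.+1) => //; rewrite fE //.
  move: h; rewrite !entry_gt0 // => /andP[-> h]; exact: ltnW.
- move=> r s rs sT; apply: h2 => //; rewrite fE entry_gt0 //.
    by rewrite (ltn_trans rs sT); have /andP[] := allP pT _ (mem_nth [::] (ltn_trans rs sT)).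
  by rewrite sT; have /andP[] := allP pT _ (mem_nth [::] sT).
move=> r s c rs s0 hle; have := h3 r s c rs; rewrite !fE !iE /= s0 hle andbT.
by move=> /(_ isT (leq_trans s0 hle)) /andP[].
Qed.

Lemma straight_of_ssrct T : ssrct T -> is_SSRCT T (map size T) [::].
Proof.
move=> wT; have pT := ssrct_positive wT.
have fE r c : filled T r c = (0 < entry T r c).
  by rewrite /filled in_diag_positive // -lt0n andbb.
have iE r c : inner T r c = false.
  by rewrite /inner in_diag_positive // lt0n andNb.
split.
- apply/and5P; split=> //; first exact: is_comp_shape.
  apply/allP => r; rewrite mem_iota add0n size_map /= => rT.
  rewrite cats0 nth_nseq if_same /=; apply/allP => c; rewrite mem_iota add0n (nth_map [::]) //= => cr.
  by rewrite ltn0 eqbF_neg -lt0n entry_gt0 // rT.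
- move=> r c c' cc _ _; rewrite -(subnKC (ltnW cc)).
  elim: (c' - c) => [|d IH]; first by rewrite addn0.
  by rewrite addnS; apply: leq_trans (ssrct_row wT _ _) IH.
- move=> r s rs _; rewrite fE entry_gt0 // => /andP[sT _]; exact: ssrct_first wT _ _ rs sT.
move=> r s c rs; rewrite !fE !iE /= => s0 /andP[_ hle].
have h := ssrct_trip wT rs s0 hle; rewrite h andbT; exact: leq_ltn_trans h.
Qed.

Definition hide_above (n : nat) (T : tab) : tab :=
  map (map (fun x => if n < x then 0 else x)) T.

Lemma entry_hide n T r c :
  entry (hide_above n T) r c = if n < entry T r c then 0 else entry T r c.
Proof.
rewrite /entry; have [rT|rT] := ltnP r (size T); last first.
  by rewrite !(nth_default [::]) ?size_map // nth_nil.
rewrite (nth_map [::]) //; have [cr|cr] := ltnP c (size (nth [::] T r)).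
  by rewrite (nth_map 0).
by rewrite (nth_default 0 (s := nth [::] T r)) // nth_default ?size_map.
Qed.

Lemma shape_hide n T : map size (hide_above n T) = map size T.
Proof. by rewrite -map_comp; apply: eq_map => row /=; rewrite size_map. Qed.

(** Bullets exceed all visible entries, so an inner box behaves like an entry above [n], and the
    skew triple rule is the straight one read before hiding. *)
Lemma is_SSRCT_hide n T : ssrct T ->
  is_SSRCT (hide_above n T) (map size T) (map size (bullets n T)).
Proof.
move=> wT; have pT := ssrct_positive wT; have wP := ssrct_bullets n wT.
have dE r c : in_diag (hide_above n T) r c = (0 < entry T r c).
  rewrite entry_gt0 // /in_diag size_map; have [rT|//] := ltnP r (size T).
  by rewrite (nth_map [::]) // size_map.
have fE r c : filled (hide_above n T) r c = (0 < entry T r c) && (entry T r c <= n).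
  rewrite /filled dE entry_hide; have [h|h] := ltnP n (entry T r c); first by rewrite eqxx.
  by rewrite -lt0n andbb andbT.
have iE r c : inner (hide_above n T) r c = (n < entry T r c).
  rewrite /inner dE entry_hide; have [h|h] := ltnP n (entry T r c); last by rewrite lt0n andNb.
  by rewrite (leq_ltn_trans (leq0n n) h).
have fle r c : filled (hide_above n T) r c -> entry (hide_above n T) r c = entry T r c.
  by rewrite fE entry_hide => /andP[_]; rewrite leqNgt => /negPf ->.
have hd : first_bullet n T <= size T by apply: find_size.
split.
- apply/and5P; split; [by rewrite shape_hide | exact: is_comp_shape | | |].
  + exact/is_comp_shape/positive_bullets.
  + by rewrite !size_map size_filter count_size.
  have e1 : size (map size T) - size (map size (bullets n T)) = first_bullet n T.
    by rewrite !(size_map size) size_bullets // subKn.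
  apply/allP => r; rewrite mem_iota add0n e1 nth_cat size_nseq size_map /= => rT.
  have rowE : nth 0 (map size T) r = size (nth [::] T r) by rewrite (nth_map [::]).
  set g := if _ then _ else _.
  (* The padded part [g] is the number of bullets in row r, since bullets come first in each row. *)
  have gE c : (c < g) = (n < entry T r c).
    rewrite /g; have [rd|rd] := ltnP r (first_bullet n T).
      rewrite nth_nseq rd ltn0; symmetry; apply/negbTE; rewrite -leqNgt.
      have := before_find [::] rd; rewrite -nth0 => /negbT; rewrite -leqNgt; apply: leq_trans.
      by elim: c => //= c IH; apply: leq_trans (ssrct_row wT r c) IH.
    have rp : r - first_bullet n T < size (bullets n T) by rewrite size_bullets // ltn_sub2r //; lia.
    rewrite (nth_map [::]) //.
    have := entry_gt0 (r - first_bullet n T) c (positive_bullets n T).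
    by rewrite rp /= => <-; rewrite entry_bullets // subnKC // subn_gt0.
  apply/andP; split.
    rewrite rowE leqNgt; apply/negP; rewrite gE => h.
    by move: h; rewrite /entry nth_default.
  apply/allP => c; rewrite mem_iota add0n rowE /= => cr.
  have e0 : 0 < entry T r c by rewrite entry_gt0 // rT.
  rewrite gE entry_hide; case: ltnP => h //.
  by rewrite eqbF_neg -lt0n.
- move=> r c c' cc f1 f2; rewrite !fle //; rewrite -(subnKC (ltnW cc)).
  elim: (c' - c) => [|d IH]; first by rewrite addn0.
  by rewrite addnS; apply: leq_trans (ssrct_row wT _ _) IH.
- move=> r s rs f1 f2; rewrite !fle //; apply: ssrct_first => //.
  by move: f2; rewrite /filled /in_diag size_map => /andP[/andP[]].
move=> r s c rs f; rewrite (fle s c.+1 f) !iE !fE !entry_hide; move: f; rewrite fE => /andP[s0 sn].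
move=> h; have hle : entry T s c.+1 <= entry T r c.
  case/orP: h => [h|/andP[/andP[_ h]]]; first exact: leq_trans sn (ltnW h).
  by rewrite ltnNge h.
have := ssrct_trip wT rs s0 hle; case: (ltnP n (entry T r c.+1)) => //= h1 h2.
by rewrite h2 !andbT; apply: leq_ltn_trans h2.
Qed.

Lemma perm_hide n m T : perm_eq (flatten T) (iota 1 (n + m)) ->
  perm_eq [seq x <- flatten (hide_above n T) | x != 0]
    (iota 1 (count (fun x => x != 0) (flatten (hide_above n T)))).
Proof.
move=> pT; suff p : perm_eq [seq x <- flatten (hide_above n T) | x != 0] (iota 1 n).
  by rewrite -size_filter (perm_size p) size_iota.
rewrite /hide_above -map_flatten.
apply: perm_trans (perm_filter _ (perm_map _ pT)) _.
rewrite iotaD map_cat filter_cat.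
rewrite [X in X ++ _](_ : _ = iota 1 n); last first.
  have -> : [seq (if n < x then 0 else x) | x <- iota 1 n] = iota 1 n.
    rewrite -[RHS]map_id; apply/eq_in_map => x; rewrite mem_iota add1n ltnS => /andP[_ h].
    by rewrite ltnNge h.
  by apply/all_filterP/allP => x; rewrite mem_iota; lia.
rewrite (_ : filter _ _ = [::]) ?cats0 //.
apply/eqP; rewrite -(negbK (_ == _)) -has_filter -all_predC; apply/allP => y /mapP[x].
by rewrite mem_iota => /andP[h _] ->; rewrite /= ifT.
Qed.

Lemma good_of_ssrct T : ssrct T -> uniq (flatten T) -> good T.
Proof. by move=> [h1 h2 h3 h4] /uniq_flatten_good[h5 h6]; split. Qed.

Lemma maxT_standard T n : perm_eq (flatten T) (iota 1 n) -> maxT T = n.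
Proof.
move=> p; apply/eqP; rewrite eqn_leq; apply/andP; split.
  have : {in flatten T, forall x, x <= n} by move=> x; rewrite (perm_mem p) mem_iota; lia.
  rewrite /maxT; elim: (flatten T) => //= x s IH h; rewrite geq_max h ?mem_head //= IH // => y ys.
  by apply: h; rewrite inE ys orbT.
case: n p => // n p; apply: mem_le_maxT; rewrite (perm_mem p) mem_iota; lia.
Qed.

Lemma standard_run T js n : good T -> valid T js -> perm_eq (flatten T) (iota 1 n) ->
  perm_eq (flatten (run T js)) (iota 1 (n + size js)).
Proof.
elim: js T n => [|j js IH] T n gT hv p; first by rewrite addn0.
have [P hv'] := valid_mu gT hv; rewrite /= addnS -addSn; apply: IH (mu_good P) hv' _.
apply: perm_trans (mu_flatten gT P) _; rewrite (maxT_standard p).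
have -> : iota 1 n.+1 = rcons (iota 1 n) n.+1 by rewrite -(addn1 n) iotaD add1n cats1 addn1.
by rewrite perm_sym perm_rcons perm_cons perm_sym.
Qed.

Lemma ucomp_run T js : good T -> valid T js ->
  ucomp js (map size T) = Some (map size (run T js)).
Proof.
rewrite /ucomp /run; elim: js T => //= j js IH T gT hv; have [P hv'] := valid_mu gT hv.
by rewrite -(mu_shape P) IH //; apply: mu_good P.
Qed.

Lemma slides_valid T js : all (fun j => 0 < j) js -> slides_defined T js -> valid T js.
Proof.
elim: js T => //= j js IH T /andP[j0 hj] /andP[ha hs]; rewrite j0 IH // andbT.
case/hasP: ha => r _ /andP[/eqP e _]; case: posnP => //= jpos.
rewrite -(mem_sort geq) -e mem_nth // ltnNge; apply/negP => h.
by move: jpos; rewrite -e nth_default.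
Qed.

(* js = [:: j_1; ...; j_m];  w = j_m ... j_1 = rev js *)
Theorem theorem8p10 (n : nat) (alpha : seq nat) (tau1 : tab) (js : seq nat) :
  is_comp alpha -> sumn alpha = n ->
  is_SRCT tau1 alpha [::] ->
  all (fun j => 0 < j) js ->
  slides_defined tau1 js ->
  exists beta,
    ucomp js alpha = Some beta /\
    (exists S, is_SSRCT S (map size S) [::] /\ rho S = recording (std (rev js))) /\
    (forall S, is_SSRCT S (map size S) [::] ->
       rho S = recording (std (rev js)) ->
       is_SRCT (bullet n tau1 js) beta (map size S)).
Proof.
move=> _ hn [hS hstd] hpos hdef.
have [ealpha wT] := ssrct_of_straight hS.
have eflat : [seq x <- flatten tau1 | x != 0] = flatten tau1.
  apply/all_filterP/allP => x /flattenP[row /(allP (ssrct_positive wT)) /andP[_ h] xr].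
  by apply: contraNneq h => <-.
have pT : perm_eq (flatten tau1) (iota 1 n).
  by move: hstd; rewrite -size_filter eflat size_flatten /shape ealpha hn.
have gT : good tau1 by apply: good_of_ssrct => //; rewrite (perm_uniq pT) iota_uniq.
have hv := slides_valid hpos hdef.
have gF := good_run gT hv; have wF := good_ssrct gF.
have hrho := rho_bullets_run gT hv; rewrite (maxT_standard pT) in hrho.
exists (map size (run tau1 js)); split; first by rewrite -ealpha ucomp_run.
split.
  (* The relabelled bullets are an explicit preimage of the recording tableau. *)
  by exists (bullets n (run tau1 js)); split=> //; apply/straight_of_ssrct/ssrct_bullets.
move=> S /ssrct_of_straight[_ wS]; rewrite -hrho => /(rho_inj wS (ssrct_bullets n wF)) ->.
split; first exact: is_SSRCT_hide.
exact: perm_hide (standard_run gT hv pT).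
Qed.
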